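(* For every $r\in\mathbb{N}$ and $s\in\mathbb{C}$ (as an identity of meromorphic functions of $s$ on $\mathbb{C}$), $$\sum_{j=0}^{r-1}\binom{r-1}{j}(-1)^j\,\zeta(2)^{r-1-j}\,\xi_{MT}(\{2\}^{j};s)=\sum_{j=0}^{r-1}\binom{r-1}{j}(s)_j\,\zeta_{MT,r}(\{2\}^{r-1-j},\{1\}^{j},0;s+j).$$
   Context: $\mathbb{N}=\{1,2,3,\dots\}$. $\{a\}^{n}$ denotes $n$ repetitions of $a$ (empty if $n=0$). $\zeta$ is the Riemann zeta function. $(s)_j=s(s+1)\cdots(s+j-1)$ is the Pochhammer symbol, $(s)_0=1$. For $k\in\mathbb{N}$ and $|z|<1$, $\mathrm{Li}_k(z)=\sum_{m=1}^\infty z^m/m^k$. For $(k_1,\dots,k_n)\in\mathbb{N}^n$ and $\Re(s)>1-n$, $$\xi_{MT}(k_1,\dots,k_n;s)=\frac{1}{\Gamma(s)}\int_0^\infty\frac{t^{s-1}}{e^t-1}\prod_{j=1}^n\mathrm{Li}_{k_j}(1-e^{-t})\,dt ;$$ this function of $s$ continues analytically to an entire function, denoted by the same symbol. For the empty index ($n=0$), $\xi_{MT}(\emptyset;s)=\zeta(s)$. The Mordell-Tornheim $r$-ple zeta function is $$\zeta_{MT,r}(s_1,\dots,s_r;s_{r+1})=\sum_{m_1,\dots,m_r=1}^\infty\frac{1}{m_1^{s_1}\cdots m_r^{s_r}(m_1+\cdots+m_r)^{s_{r+1}}}$$ where the series converges absolutely; it continues meromorphically to $\mathbb{C}^{r+1}$.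 With $s_1,\dots,s_r$ fixed to be nonnegative integers, the series converges absolutely when $\Re(s_{r+1})>r$, and $\zeta_{MT,r}(s_1,\dots,s_r;s_{r+1})$ is understood, as a function of $s_{r+1}$, as the meromorphic continuation to $\mathbb{C}$. *)

(* Defs.v *)
From HB Require Import structures.
From mathcomp Require Import all_boot all_order all_algebra.
From mathcomp Require Import complex.
From mathcomp Require Import all_classical all_reals all_analysis.
From mathcomp Require summability.

Set Implicit Arguments.
Unset Strict Implicit.
Unset Printing Implicit Defensive.

Import Order.TTheory GRing.Theory Num.Theory.
Import numFieldNormedType.Exports.

Local Open Scope classical_set_scope.
Local Open Scope ring_scope.
Local Open Scope complex_scope.

(* R[i] only receives its norm topology through the alias R[i]^o; a function
   or point of R[i] is cast to R[i]^o wherever a filter or a limit is taken. *)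

Section ComplexAnalysis.
Variable R : realType.
Implicit Types (f g : R[i] -> R[i]) (s z : R[i]) (t : R).

Definition analytic_at f z0 : Prop :=
  exists a : nat -> R[i], \forall z \near (z0 : R[i]^o),
    (series (fun n => a n * (z - z0) ^+ n) : nat -> R[i]^o) @ \oo
      --> (f z : R[i]^o).

Definition entire f : Prop := forall z, analytic_at f z.

(* A meromorphic function is represented by a total function whose values at
   its poles are irrelevant: near each point it is, on a punctured
   neighbourhood, (z - z0)^-n times an analytic function. *)
Definition meromorphic f : Prop :=
  forall z0, exists n : nat, exists2 g, analytic_at g z0 &
    \forall z \near (z0 : R[i]^o)^', (z - z0) ^+ n * f z = g z.

(* Equality of meromorphic functions: agreement off a discrete set, and
   agreement at every point where both representatives are regular. *)
Definition mero_eq f g : Prop :=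
  forall z0, (\forall z \near (z0 : R[i]^o)^', f z = g z) /\
             (analytic_at f z0 -> analytic_at g z0 -> f z0 = g z0).

(* t ^ s = exp (s ln t), meaningful for t > 0 only *)
Definition cpow t s : R[i] :=
  (t `^ complex.Re s)%:C *
  (cos (complex.Im s * ln t) +i* sin (complex.Im s * ln t)).

(* Lebesgue integral of a complex-valued function over (0, +oo) *)
Definition Cint0oo (F : R -> R[i]) : R[i] :=
  (\int[@lebesgue_measure R]_(t in `]0, +oo[) complex.Re (F t))%R +i*
  (\int[@lebesgue_measure R]_(t in `]0, +oo[) complex.Im (F t))%R.

Definition pochhammer s (j : nat) : R[i] := \prod_(i < j) (s + i%:R).

(* Euler's integral, equal to Gamma s when 0 < Re s *)
Definition Euler_Gamma s : R[i] :=
  Cint0oo (fun t => (expR (- t))%:C * cpow t (s - 1)).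

(* The entire function 1 / Gamma: Euler's integral is shifted to the half-plane
   0 < Re by Gamma s = Gamma (s + n) / (s)_n, with n = 0 when 0 < Re s. *)
Definition inv_Gamma s : R[i] :=
  let n := if 0 < complex.Re s then 0%N
           else (Num.truncn (- complex.Re s)).+1 in
  pochhammer s n / Euler_Gamma (s + n%:R).

Definition zeta_series s : R[i] :=
  limn (series (fun n => cpow n.+1%:R (- s)) : nat -> R[i]^o).

Definition is_zeta (zeta : R[i] -> R[i]) : Prop :=
  meromorphic zeta /\
  forall s, 1 < complex.Re s -> zeta s = zeta_series s.

(* Li_k, needed at real arguments only *)
Definition polylog (k : nat) (x : R) : R :=
  limn (series (fun m => x ^+ m.+1 / m.+1%:R ^+ k)).

Definition xiMT_integral (ks : seq nat) s : R[i] :=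
  inv_Gamma s *
  Cint0oo (fun t => cpow t (s - 1) *
    ((expR t - 1)^-1 * \prod_(k <- ks) polylog k (1 - expR (- t)))%:C).

(* xi is the continuation of s |-> xi_MT(ks; s), which is entire unless
   ks is empty, where it is the zeta function. *)
Definition is_xiMT (ks : seq nat) (xi : R[i] -> R[i]) : Prop :=
  if ks is [::] then is_zeta xi else
  entire xi /\
  forall s, 1 - (size ks)%:R < complex.Re s -> xi s = xiMT_integral ks s.

(* The r-fold series with first exponents ks = (s_1, ..., s_r) and last
   exponent s, summed unconditionally over the tuples
   (m_1, ..., m_r) = (m 0 + 1, ..., m (r-1) + 1). *)
Definition zetaMT_series (ks : seq nat) s : R[i] :=
  summability.sum (R := R[i]^o)
    (fun m : {ffun 'I_(size ks) -> nat} =>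
      (\prod_(i < size ks) (m i).+1%:R ^+ nth 0%N ks i)^-1%:C *
      cpow (\sum_(i < size ks) (m i).+1)%:R (- s)).

Definition is_zetaMT (ks : seq nat) (Z : R[i] -> R[i]) : Prop :=
  meromorphic Z /\
  forall s, (size ks)%:R < complex.Re s -> Z s = zetaMT_series ks s.

End ComplexAnalysis.

(* Main.v *)
Require Import Defs.
From HB Require Import structures.
From mathcomp Require Import all_boot all_order all_algebra.
From mathcomp Require Import complex.
From mathcomp Require Import all_classical all_reals all_analysis.
From mathcomp Require Import measurable_realfun finmap ring lra.
From mathcomp Require summability.

(** Why the identity holds. Write [Li_k] for [polylog k]. By Euler's reflection
    formula for the dilogarithm,
      [zeta(2) - Li_2 (1 - e^-t) = Li_2 (e^-t) + t Li_1 (e^-t)]   for [t > 0]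
    ([dilog_reflection]: the difference of the two sides has derivative zero and
    tends to zero at infinity). Raise both sides to the power [r - 1], multiply by
    [t^(s-1) / (e^t - 1)], integrate over the positive reals and divide by
    Gamma(s).

    On the left the binomial theorem gives the combination of the functions
    xi_MT({2}^j; s). On the right, since [1 / (e^t - 1) = Li_0 (e^-t)], it gives
    the integrals of [t^(s+j-1) Li_2^(r-1-j) Li_1^j Li_0] at [e^-t]. Such a product
    of polylogarithms is the multiple series of the terms
    [e^(-(m_1 + .. + m_r) t) / (m_1^2 .. )]; integrated termwise it is
    Gamma(s + j) zeta_MT({2}^(r-1-j), {1}^j, 0; s + j), and
    Gamma(s + j) / Gamma(s) = (s)_j. The exchange of sum and integral is done on
    the finite boxes [m_i <= N], followed by monotone convergence
    ([cvg_box_sum]); the unconditional sum of a nonnegative family is its limit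
    along boxes ([sum_cvg_box]).

    This computation is carried out for real [s > r + 1] only
    ([xi_zetaMT_sum_real]). Both sides are meromorphic in [s], and a meromorphic
    function that vanishes on a real half-line vanishes identically
    ([meromorphic_identity]): zeros of a power series are isolated
    ([pseries_isolated_zero]), and any two complex numbers are joined by a segment. *)

Set Implicit Arguments.
Unset Strict Implicit.
Unset Printing Implicit Defensive.

Import Order.TTheory GRing.Theory Num.Theory.
Import numFieldNormedType.Exports.
Local Open Scope classical_set_scope.
Local Open Scope ring_scope.
Local Open Scope complex_scope.

(** * Isolated zeros of power series *)

Lemma sum_geometric_tail (K : numDomainType) (q : K) (k n : nat) :
  0 <= q -> q *+ 2 <= 1 -> \sum_(k <= i < k + n) q ^+ i <= q ^+ k *+ 2.
Proof.
move=> q0 q2.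
suff: \sum_(k <= i < k + n) q ^+ i + q ^+ (k + n) *+ 2 <= q ^+ k *+ 2.
  by apply: le_trans; rewrite lerDl mulrn_wge0// exprn_ge0.
elim: n => [|n IH]; first by rewrite addn0 big_geq// add0r.
rewrite addnS big_nat_recr ?leq_addr//= -addrA; apply: le_trans IH.
rewrite lerD2l [leRHS]mulr2n lerD2l exprS -mulrnAl.
by rewrite -[leRHS]mul1r ler_wpM2r// exprn_ge0.
Qed.

(** If [a k] is the first nonzero coefficient, then [a k * w ^+ k] dominates near
    the centre: the terms are bounded at one fixed radius [d], so the remaining
    terms add up to at most a multiple of [`|w| ^+ k.+1]. *)
Lemma pseries_isolated_zero (K : numFieldType) (a : nat -> K) (g : K -> K)
    (z0 : K) :
  (\forall z \near (z0 : K^o),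
    (series (fun n => a n * (z - z0) ^+ n) : nat -> K^o) @ \oo
      --> (g z : K^o)) ->
  (\forall z \near (z0 : K^o), g z = 0) \/
  (\forall z \near (z0 : K^o)^', g z != 0).
Proof.
move=> /nbhs_normP[/= rho rho0 cvg_g].
have [[n an]|a0] := pselect (exists n, a n != 0); last first.
  left; apply/nbhs_normP; exists rho => //= z /cvg_g.
  suff -> : series (fun n => a n * (z - z0) ^+ n) = cst (0 : K^o).
    move=> h; exact: (norm_cvg_unique h (cvg_cst _)).
  apply/funext => n; rewrite /series /= big1// => i _.
  by have [->|ai] := eqVneq (a i) 0; [rewrite mul0r | case: a0; exists i].
have ex_a : exists n, (fun n => a n != 0) n by exists n.
right; case: (ex_minnP ex_a) => k ak kmin {n an ex_a}.
pose d := rho / 2.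
have d0 : 0 < d by rewrite divr_gt0.
have [M M0 aM] : exists2 M, 0 < M & forall n, (k < n)%N -> `|a n| * d ^+ n <= M.
  have : ball_ Num.norm z0 rho (z0 + d).
    rewrite /ball_/= opprD addNKr normrN gtr0_norm//.
    by rewrite /d ltr_pdivrMr// mulr_natr mulr2n ltrDl.
  move=> /cvg_g h.
  have : (fun n => a n * (z0 + d - z0) ^+ n : K^o) @ \oo --> (0 : K^o).
    by apply: cvg_series_cvg_0; apply/cvg_ex; eexists; exact: h.
  move=> /cvgrPdist_lt/(_ 1 ltr01)[N _ aN].
  pose M := 1 + \sum_(i < N) `|a i| * d ^+ i.
  have S0 : 0 <= \sum_(i < N) `|a i| * d ^+ i.
    by apply: sumr_ge0 => i _; rewrite mulr_ge0 ?exprn_ge0// ltW.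
  exists M => [|n _]; first by rewrite ltr_wpDr.
  have [nN|Nn] := ltnP n N.
    rewrite /M (bigD1 (Ordinal nN))//= addrCA lerDl addr_ge0//.
    by apply: sumr_ge0 => i _; rewrite mulr_ge0 ?exprn_ge0// ltW.
  have := aN n Nn; rewrite /= sub0r normrN addrAC subrr add0r normrM normrX.
  by rewrite (gtr0_norm d0) => /ltW h1; rewrite (le_trans h1)// lerDl.
pose e1 := `|a k| * d ^+ k.+1 / (M *+ 2); pose e2 := d / 2.
have e10 : 0 < e1.
  by rewrite divr_gt0 ?mulr_gt0 ?exprn_gt0 ?mulrn_wgt0// normr_gt0.
have e20 : 0 < e2 by rewrite divr_gt0.
have e120 : 0 < e1 + e2 by rewrite addr_gt0.
(* The radius is smaller than both e1 and e2; it stands for their minimum,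
   since K may be only partially ordered. Below e1 the leading term wins, and
   below e2 the ratio of the geometric majorant is at most 1/2. *)
apply/nbhs_normP; exists (e1 * (e2 / (e1 + e2))) => /=.
  by rewrite mulr_gt0// divr_gt0.
move=> z /=; rewrite distrC => ze zz0; set w := z - z0.
have w0 : 0 < `|w| by rewrite normr_gt0 subr_eq0.
have we1 : `|w| < e1.
  apply: (lt_trans ze); rewrite gtr_pMr// ltr_pdivrMr// mul1r.
  by rewrite ltrDr.
have we2 : `|w| < e2.
  apply: (lt_trans ze); rewrite mulrCA gtr_pMr// ltr_pdivrMr// mul1r.
  by rewrite ltrDl.
apply: contraTneq isT => gz0; exfalso.
have : ball_ Num.norm z0 rho z.
  rewrite /ball_/= distrC (lt_trans we2)// /e2 /d.
  rewrite ltr_pdivrMr// ltr_pdivrMr// -mulrA -natrM mulr_natr.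
  by rewrite -mulr_natr ltr_pMr// ltr1n.
move=> /cvg_g; rewrite gz0 -/w => h.
have : `|a k * w ^+ k| <= M * (`|w| / d) ^+ k.+1 *+ 2.
  have qd : `|w| / d *+ 2 <= 1.
    rewrite -mulr_natr mulrAC ler_pdivrMr// mul1r.
    by rewrite -ler_pdivlMr//; exact: ltW.
  have q0 : 0 <= `|w| / d by rewrite divr_ge0 ?ltW.
  have Sbound N : `|a k * w ^+ k - series (fun n => a n * w ^+ n) (k.+1 + N)%N|
       <= M * (`|w| / d) ^+ k.+1 *+ 2.
    rewrite /series/= (@big_cat_nat _ _ _ k.+1) ?leq_addr//=.
    rewrite big_nat_recr//= [X in _ - (X + _ + _)]big1_seq ?add0r; last first.
      move=> i; rewrite mem_index_iota/= => ik.
      have [->|ai] := eqVneq (a i) 0; first by rewrite mul0r.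
      by have := kmin i ai; rewrite leqNgt ik.
    rewrite opprD addNKr normrN (le_trans (ler_norm_sum _ _ _))//.
    rewrite -mulrnAr.
    apply: le_trans (ler_wpM2l (ltW M0) (sum_geometric_tail k.+1 N q0 qd)).
    rewrite mulr_sumr big_nat_cond [leRHS]big_nat_cond.
    apply: ler_sum => i; rewrite andbT => /andP[ki _].
    rewrite normrM normrX expr_div_n mulrA ler_pdivlMr ?exprn_gt0//.
    by rewrite mulrAC ler_pM2r ?exprn_gt0// aM.
  set B := (X in _ <= X) in Sbound *.
  have B0 : 0 <= B by apply: le_trans (Sbound 0%N).
  rewrite real_leNgt ?normr_real ?ger0_real//; apply/negP => Bk.
  move/cvgrPdist_lt : h => /(_ (`|a k * w ^+ k| - B)).
  rewrite subr_gt0 => /(_ Bk)[N _ /(_ (k.+1 + N)%N (leq_addl _ _))] /=.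
  rewrite sub0r normrN ltrBrDl => h2.
  have := lerD (Sbound N) (lexx `|series (fun n => a n * w ^+ n) (k.+1 + N)%N|).
  move=> /(le_trans (ler_normD _ _)); rewrite subrK => /le_lt_trans/(_ h2).
  by rewrite ltxx.
rewrite normrM normrX expr_div_n [X in X / _]exprS => h1.
have : `|a k| <= `|w| * (M *+ 2) / d ^+ k.+1.
  rewrite -(@ler_pM2r _ (`|w| ^+ k)) ?exprn_gt0//; apply: (le_trans h1).
  rewrite le_eqVlt; apply/orP; left; apply/eqP.
  by rewrite -mulrnAl !mulrA [_ *+ 2 * _]mulrC mulrAC.
rewrite ler_pdivlMr ?exprn_gt0// -ler_pdivrMr ?mulrn_wgt0//.
by rewrite real_leNgt ?ger0_real ?(ltW w0) ?(ltW e10)// we1.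
Qed.

Lemma near_addr (K : numFieldType) (P : K -> Prop) (z0 c : K) :
  (\forall z \near (z0 + c : K^o), P z) ->
  \forall z \near (z0 : K^o), P (z + c).
Proof.
move=> /nbhs_normP[/= e e0 Pe]; apply/nbhs_normP; exists e => //= z ze.
by apply: Pe; rewrite /ball_/= opprD addrACA subrr addr0.
Qed.

Lemma dnear_addr (K : numFieldType) (P : K -> Prop) (z0 c : K) :
  (\forall z \near (z0 + c : K^o)^', P z) ->
  \forall z \near (z0 : K^o)^', P (z + c).
Proof.
move=> /(@near_addr K (fun z => z != z0 + c -> P z)).
apply: (@filterS K (nbhs (z0 : K^o))) => z /= Pz zz0.
by apply: Pz; rewrite (inj_eq (addIr c)).
Qed.

(** Makes both vanishing near a point and not vanishing near a point, punctured
    as they are, open conditions on the point. *)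
Lemma dnear_dnear (K : numFieldType) (P : K -> Prop) (z : K) :
  (\forall w \near (z : K^o)^', P w) ->
  \forall z' \near (z : K^o), \forall w \near (z' : K^o)^', P w.
Proof.
move=> Pz.
have := @nbhs_interior K^o z (fun w => w != z -> P w) Pz.
apply: (@filterS K (nbhs (z : K^o))) => z' /= Qz'.
have [->//|zz'] := eqVneq z' z.
have wz : \forall w \near (z' : K^o), w != z.
  apply/nbhs_normP; exists `|z' - z| => /=; first by rewrite normr_gt0 subr_eq0.
  by move=> w; apply: contraTneq => ->; rewrite /ball_/= ltxx.
apply: (@filterS2 K (nbhs (z' : K^o)) _ _ _ _ _ Qz' wz) => w /= + wz0 _.
exact.
Qed.

(** * Closure properties of meromorphic functions *)

Section Analytic.
Variable R : realType.
Implicit Types (f g : R[i] -> R[i]) (z : R[i]).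

Lemma analytic_atD f g z0 : analytic_at f z0 -> analytic_at g z0 ->
  analytic_at (fun z => f z + g z) z0.
Proof.
move=> [a fa] [b gb]; exists (fun n => a n + b n).
apply: filterS2 fa gb => z fz gz.
have -> : series (fun n => (a n + b n) * (z - z0) ^+ n) =
   (fun N => series (fun n => a n * (z - z0) ^+ n) N +
             series (fun n => b n * (z - z0) ^+ n) N).
  apply/funext => N; rewrite /series /= -big_split /=.
  by apply: eq_bigr => i _; rewrite mulrDl.
exact: (@cvgD _ R[i]^o _ _ _ _ _ _ _ fz gz).
Qed.

Lemma analytic_atZ c f z0 : analytic_at f z0 ->
  analytic_at (fun z => c * f z) z0.
Proof.
move=> [a fa]; exists (fun n => c * a n).
apply: filterS fa => z fz.
have -> : series (fun n => (c * a n) * (z - z0) ^+ n) =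
   (fun N => c * series (fun n => a n * (z - z0) ^+ n) N).
  apply/funext => N; rewrite /series /= mulr_sumr.
  by apply: eq_bigr => i _; rewrite mulrA.
exact: (@cvgMr R[i] _ _ _ _ _ _ fz).
Qed.

Lemma analytic_at_mulX f z0 : analytic_at f z0 ->
  analytic_at (fun z => (z - z0) * f z) z0.
Proof.
move=> [a fa]; exists (fun n => if n is n.+1 then a n else 0).
apply: filterS fa => z fz.
rewrite -cvg_shiftS.
have -> : (fun N => series (fun n => (if n is n.+1 then a n else 0) *
    (z - z0) ^+ n) N.+1) =
   (fun N => (z - z0) * series (fun n => a n * (z - z0) ^+ n) N).
  apply/funext => N; rewrite /series /= mulr_sumr big_nat_recl//= mul0r add0r.
  by apply: eq_bigr => i _; rewrite exprS mulrCA.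
exact: (@cvgMr R[i] _ _ _ _ _ _ fz).
Qed.

Lemma eq_analytic_at f g z0 : f =1 g -> analytic_at f z0 -> analytic_at g z0.
Proof. by move=> /funext ->. Qed.

Lemma eq_meromorphic f g : f =1 g -> meromorphic f -> meromorphic g.
Proof. by move=> /funext ->. Qed.

Lemma analytic_at_mulXn f z0 n : analytic_at f z0 ->
  analytic_at (fun z => (z - z0) ^+ n * f z) z0.
Proof.
elim: n => [|n IH] fz0.
  by apply: eq_analytic_at fz0 => z; rewrite mul1r.
by apply: eq_analytic_at (analytic_at_mulX (IH fz0)) => z; rewrite exprS mulrA.
Qed.

Lemma analytic_at_shift f c z0 : analytic_at f (z0 + c) ->
  analytic_at (fun z => f (z + c)) z0.
Proof.
move=> [a fa]; exists a.
apply: filterS (near_addr fa) => z.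
by rewrite opprD addrACA subrr addr0.
Qed.

Lemma meromorphicD f g : meromorphic f -> meromorphic g ->
  meromorphic (fun z => f z + g z).
Proof.
move=> mf mg z0; have [n [f1 af ff1]] := mf z0; have [m [g1 ag gg1]] := mg z0.
exists (n + m)%N, (fun z => (z - z0) ^+ m * f1 z + (z - z0) ^+ n * g1 z).
  by apply: analytic_atD; apply: analytic_at_mulXn.
by apply: filterS2 ff1 gg1 => z <- <-; rewrite exprD; ring.
Qed.

Lemma meromorphicZ c f : meromorphic f -> meromorphic (fun z => c * f z).
Proof.
move=> mf z0; have [n [f1 af ff1]] := mf z0.
exists n, (fun z => c * f1 z); first exact: analytic_atZ.
by apply: filterS ff1 => z <-; rewrite mulrCA.
Qed.

Lemma meromorphic_mulXD c f : meromorphic f ->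
  meromorphic (fun z => (z + c) * f z).
Proof.
move=> mf z0; have [n [f1 af ff1]] := mf z0.
exists n, (fun z => (z - z0) * f1 z + (z0 + c) * f1 z).
  by apply: analytic_atD; [exact: analytic_at_mulX|exact: analytic_atZ].
by apply: filterS ff1 => z <-; ring.
Qed.

Lemma meromorphic_shift c f : meromorphic f -> meromorphic (fun z => f (z + c)).
Proof.
move=> mf z0; have [n [f1 af ff1]] := mf (z0 + c).
exists n, (fun z => f1 (z + c)); first exact: analytic_at_shift.
apply: filterS (dnear_addr ff1) => z.
by rewrite opprD addrACA subrr addr0.
Qed.

Lemma entire_meromorphic f : entire f -> meromorphic f.
Proof.
move=> ef z0; exists 0%N, f; first exact: ef.
by near=> z; rewrite mul1r.
Unshelve. all: by end_near. Qed.

Lemma meromorphic_pochhammer j f : meromorphic f ->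
  meromorphic (fun z => pochhammer z j * f z).
Proof.
move=> mf; elim: j => [|j IH].
  by apply: eq_meromorphic mf => z; rewrite /pochhammer big_ord0 mul1r.
apply: eq_meromorphic (meromorphic_mulXD j%:R IH) => z.
by rewrite /pochhammer big_ord_recr/= mulrA [X in X * _]mulrC.
Qed.

Lemma meromorphic_sum (F : nat -> R[i] -> R[i]) n :
  (forall j, (j < n)%N -> meromorphic (F j)) ->
  meromorphic (fun z => \sum_(0 <= j < n) F j z).
Proof.
elim: n => [|n IH] mF.
  move=> z0; exists 0%N, (fun=> 0).
    exists (fun=> 0); near=> z.
    rewrite (_ : series _ = cst (0 : R[i]^o)); first exact: cvg_cst.
    by apply/funext => N; rewrite /series/= big1// => i _; rewrite mul0r.
  by near=> z; rewrite big_geq// mulr0.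
have mFn := IH (fun j jn => mF j (ltnW jn)).
by apply: eq_meromorphic (meromorphicD mFn (mF n (ltnSn n))) => z;
  rewrite big_nat_recr.
Unshelve. all: by end_near. Qed.

End Analytic.

(** * The identity theorem *)

Section Identity.
Variable R : realType.
Implicit Types (f g h : R[i] -> R[i]) (z : R[i]).

Lemma meromorphic_isolated_zero h z0 : meromorphic h ->
  (\forall z \near (z0 : R[i]^o)^', h z = 0) \/
  (\forall z \near (z0 : R[i]^o)^', h z != 0).
Proof.
move=> /(_ z0)[n [g [a ga] hg]].
have [g0|g0] := pseries_isolated_zero ga; [left|right].
  have {}g0 : \forall z \near (z0 : R[i]^o)^', g z = 0.
    exact: (@nbhs_dnbhs R[i]^o).
  have zz0 : \forall z \near (z0 : R[i]^o)^', z != z0.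
    exact: (@nbhs_dnbhs_neq R[i]^o).
  apply: filterS3 hg g0 zz0 => z hgz gz zz0.
  move/eqP: hgz; rewrite gz mulf_eq0 expf_eq0 subr_eq0 (negPf zz0) andbF.
  by move=> /eqP.
apply: filterS2 hg g0 => z <-.
by rewrite mulf_eq0 negb_or => /andP[].
Qed.

(** Continuity of the affine path [u |-> z0 + u d]: a condition that holds near a
    point of a complex line holds near the corresponding real parameter, which
    brings in the connectedness of the real line. *)
Lemma near_segment (z0 d : R[i]) (t : R) (P : R[i] -> Prop) :
  (\forall z \near (z0 + t%:C * d : R[i]^o), P z) ->
  \forall u \near t, P (z0 + u%:C * d).
Proof.
move=> /nbhs_normP[/= e e0 Pe].
have d1 : 0 < `|d| + 1 by rewrite ltr_wpDl.
have [x x0 xe] : exists2 x : R, 0 < x & x%:C = e / (`|d| + 1).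
  have : 0 < e / (`|d| + 1) by rewrite divr_gt0.
  case: (e / _) => a b; rewrite ltcE/= => /andP[/eqP -> a0].
  by exists a.
apply/nbhs_normP; exists x => // u; rewrite /ball_/= => tu; apply: Pe.
rewrite /ball_/= opprD addrACA subrr add0r -mulrBl -rmorphB normrM.
have -> : `|(t - u)%:C : R[i]| = `|t - u|%:C.
  by rewrite normc_def/= expr0n/= addr0 sqrtr_sqr.
have : `|t - u|%:C < e / (`|d| + 1) by rewrite -xe ltcR.
rewrite ltr_pdivlMr// mulrDr mulr1; apply: le_lt_trans.
by rewrite lerDl lecR.
Qed.

(** The punctured germs at the points of the segment from [(b + 1)%:C] to [z0] are
    each zero or nowhere zero, both alternatives are open, and the first one holds
    at the starting point since the zeros [x%:C] accumulate there; connectedness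
    of the parameter line carries it to [z0]. *)
Lemma meromorphic_identity h (b : R) : meromorphic h ->
  (forall x : R, b < x -> h x%:C = 0) ->
  forall z0, \forall z \near (z0 : R[i]^o)^', h z = 0.
Proof.
move=> mh h0 z0; pose p : R[i] := (b + 1)%:C.
pose E z := \forall w \near (z : R[i]^o)^', h w = 0.
pose N z := \forall w \near (z : R[i]^o)^', h w != 0.
have EN z : E z \/ N z by exact: meromorphic_isolated_zero.
have NE z : N z -> ~ E z.
  move=> Nz Ez; have /filter_ex[w /=] : \forall w \near (z : R[i]^o)^', False.
    by apply: filterS2 Nz Ez => w /eqP.
  by [].
have Ep : E p.
  have [//|Np] := EN p.
  have := @near_segment 0 1 (b + 1) (fun w => w != p -> h w != 0).
  rewrite add0r mulr1 => /(_ Np) Nb.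
  have bu : \forall u \near (b + 1 : R), b < u.
    by apply: lt_nbhsr; rewrite ltrDl.
  have /filter_ex[u [hu bu1 ub]] : \forall u \near (b + 1 : R)^',
      [/\ 0 + u%:C * 1 != p -> h (0 + u%:C * 1) != 0, b < u & u != b + 1].
    by apply: filterS3 (nbhs_dnbhs Nb) (nbhs_dnbhs bu) (nbhs_dnbhs_neq (b + 1)).
  have : 0 + u%:C * 1 != p.
    by rewrite add0r mulr1 /p; apply: contra ub => /eqP[->].
  by move=> /hu; rewrite add0r mulr1 h0// eqxx.
pose S := [set t : R | E (p + t%:C * (z0 - p))].
have oS : open S.
  rewrite openE => t /= Et.
  exact: (near_segment (dnear_dnear Et)).
have oN : open (~` S).
  rewrite openE => t /= Et.
  have [//|Nt] := EN (p + t%:C * (z0 - p)).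
  by apply: filterS (near_segment (dnear_dnear Nt)) => u /NE.
have ST : S = setT.
  have /connected_intervalP : is_interval [set: R] by [].
  apply.
  - by exists 0; rewrite /S /= mul0r addr0.
  - by exists S => //; rewrite setTI.
  - by exists S; [rewrite -(setCK S); exact: open_closedC|rewrite setTI].
have : S 1 by rewrite ST.
by rewrite /S /= mul1r addrC subrK.
Qed.

(** The difference vanishes on a punctured neighbourhood, so it is not nowhere
    zero there; by the dichotomy it vanishes on a full neighbourhood. *)
Lemma eq_analytic_at_center f g z0 : analytic_at f z0 -> analytic_at g z0 ->
  (\forall z \near (z0 : R[i]^o)^', f z = g z) -> f z0 = g z0.
Proof.
move=> af ag fg.
have [c ch] := analytic_atD af (analytic_atZ (-1) ag).
apply/eqP; rewrite -subr_eq0 -mulN1r.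
have [/nbhs_singleton ->//|h0] := pseries_isolated_zero ch.
have /filter_ex[w /=] : \forall w \near (z0 : R[i]^o)^', False.
  by apply: filterS2 h0 fg => w + fgw; rewrite fgw mulN1r subrr eqxx.
by [].
Qed.

(** Reduces an identity of meromorphic functions to real arguments beyond any
    bound, where all the functions involved are given by convergent real series
    and integrals. *)
Lemma meromorphic_mero_eq f g (b : R) : meromorphic f -> meromorphic g ->
  (forall x : R, b < x -> f x%:C = g x%:C) -> mero_eq f g.
Proof.
move=> mf mg fg z0.
have fg0 : \forall z \near (z0 : R[i]^o)^', f z = g z.
  have mfg := meromorphicD mf (meromorphicZ (-1) mg).
  have : forall x : R, b < x -> f x%:C + -1 * g x%:C = 0.
    by move=> x /fg ->; rewrite mulN1r subrr.
  move=> /(meromorphic_identity mfg)/(_ z0); apply: filterS => z /eqP.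
  by rewrite mulN1r subr_eq0 => /eqP.
by split=> // af ag; exact: eq_analytic_at_center.
Qed.

End Identity.

(** * The Gamma integral *)

Section GammaIntegral.
Variable R : realType.
Implicit Types (a b c t x : R) (f F : R -> R).
Local Notation mu := (@lebesgue_measure R).
Local Notation Rpos := (`]0%R, +oo[%classic : set R).

Lemma in_gt0_itv x : (x \in Rpos) = (0 < x).
Proof.
apply/idP/idP => [/set_mem|x0]; first by rewrite /= in_itv/= andbT.
by apply/mem_set; rewrite /= in_itv/= andbT.
Qed.

Lemma measurable_gt0 f : measurable_fun setT f ->
  measurable_fun Rpos f.
Proof. by apply: measurable_funS. Qed.

Lemma measurable_powR_expR b c :
  measurable_fun setT (fun t => t `^ b * expR (- (c * t))).
Proof.
apply: measurable_funM; first exact: measurable_powR.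
by apply: measurableT_comp => //; apply: measurableT_comp => //;
  exact: measurable_funM.
Qed.

(** The inequality [u <= expR u] at [u = c t / b], raised to the power [b]. *)
Lemma powR_le_expR b c : 0 < b -> 0 < c ->
  forall t, 0 <= t -> t `^ b <= (b / c) `^ b * expR (c * t).
Proof.
move=> b0 c0 t t0.
have bc0 : 0 <= b / c by rewrite divr_ge0 ?ltW.
have : t <= b / c * expR (c * t / b).
  have : c * t / b <= expR (c * t / b).
    by rewrite (le_trans _ (expR_ge1Dx _))// lerDr.
  move=> /(ler_wpM2l bc0); apply: le_trans.
  by rewrite le_eqVlt; apply/orP; left; apply/eqP; field; rewrite !gt_eqF.
move=> /(ge0_ler_powR (ltW b0) t0) => /(_ _)/le_trans; apply.
  by rewrite qualifE/= mulr_ge0// expR_ge0.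
by rewrite powRM ?expR_ge0// -expRM divfK ?gt_eqF.
Qed.

Lemma cvg_expRM_0 c : 0 < c -> expR (- (c * x)) @[x --> +oo] --> 0.
Proof.
move=> c0.
apply: (@cvg_comp _ _ _ (fun x => c * x) (fun y => expR (- y)) _
  (pinfty_nbhs R)).
  exact: gt0_cvgMry.
exact: cvgr_expR.
Qed.

Lemma is_derive_expRM c x :
  is_derive x 1 (fun t => expR (- (c * t))) (- c * expR (- (c * x))).
Proof.
have h : is_derive x 1 (fun t : R => - (c * t)) (- c).
  have -> : (fun t : R => - (c * t)) = (- c) *: (@id R).
    by apply/funext => t; rewrite -mulNr.
  by apply: is_derive_eq; rewrite /GRing.scale/= mulr1.
have := @is_derive1_comp R expR (fun t => - (c * t)) x
  (expR (- (c * x))) (- c) (is_derive_expR (- (c * x))) h.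
by rewrite mulrC.
Qed.

Lemma ge0_FTC_0y f F l :
  (forall x, 0 <= x -> 0 <= f x) ->
  (forall x, 0 < x -> is_derive x 1 F (f x)) ->
  (forall x, 0 < x -> {for x, continuous f}) ->
  f x @[x --> 0^'+] --> f 0 ->
  F x @[x --> 0^'+] --> F 0 ->
  F x @[x --> +oo] --> l ->
  (\int[mu]_(x in Rpos) (f x)%:E = (l - F 0)%:E)%E.
Proof.
move=> f0 dF cf cf0 cF0 Fl.
have cfi : {in `]0, +oo[, continuous f}.
  by move=> x; rewrite in_itv/= andbT; exact: cf.
rewrite integral_itv_obnd_cbnd; last first.
  apply/measurable_EFinP.
  apply: open_continuous_measurable_fun; first exact: interval_open.
  by move=> x; rewrite in_gt0_itv; exact: cf.
rewrite (ge0_continuous_FTC2y f0 _ Fl)//.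
- exact/continuous_within_itvcyP.
- by move=> x /dF[].
- by move=> x; rewrite in_itv/= andbT => /dF[_ <-]; rewrite derive1E.
Qed.

Lemma integral_expRM c : 0 < c ->
  (\int[mu]_(x in Rpos) (expR (- (c * x)))%:E = (c^-1)%:E)%E.
Proof.
move=> c0.
have cexp x : {for x, continuous (fun t => expR (- (c * t)))}.
  by apply/differentiable_continuous/derivable1_diffP; case: (is_derive_expRM c x).
transitivity ((0 - (fun x => - c^-1 * expR (- (c * x))) 0)%:E)%E; last first.
  by rewrite /= mulr0 oppr0 expR0 mulr1 sub0r opprK.
have dF x : 0 < x -> is_derive x 1 (fun x => - c^-1 * expR (- (c * x)))
    (expR (- (c * x))).
  move=> _; have := is_deriveZ (- c^-1) (is_derive_expRM c x).
  rewrite /GRing.scale/= => /is_derive_eq; apply.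
  by rewrite mulrA mulNr mulrN opprK mulVf ?mul1r ?gt_eqF.
apply: (ge0_FTC_0y _ dF).
- by move=> x _; exact: expR_ge0.
- by move=> x _; exact: cexp.
- exact/cvg_at_right_filter/cexp.
- by apply/cvg_at_right_filter; apply: cvgMr; exact: cexp.
- by rewrite -[X in _ --> X](mulr0 (- c^-1)); apply: cvgMr; exact: cvg_expRM_0.
Qed.

(** This is Gamma (b + 1) / c ^ (b + 1), as an extended real because integrals of
    nonnegative functions are additive without integrability conditions. *)
Definition gamma_integral b c : \bar R :=
  (\int[mu]_(t in Rpos) (t `^ b * expR (- (c * t)))%:E)%E.

Lemma gamma_integral_ge0 b c : (0 <= gamma_integral b c)%E.
Proof.
by apply: integral_ge0 => t _; rewrite lee_fin mulr_ge0 ?powR_ge0 ?expR_ge0.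
Qed.

Lemma cvg_powR_right0 b : 0 < b -> t `^ b @[t --> 0^'+] --> (0 : R) `^ b.
Proof. by move=> b0; rewrite powR0 ?gt_eqF//; exact: powR_cvg0. Qed.

Lemma continuous_powR b x : 0 < x -> {for x, continuous (fun t => t `^ b)}.
Proof.
move=> x0; apply/differentiable_continuous/derivable1_diffP.
by case: (is_derive1_powR b x0).
Qed.

Lemma continuous_expRM c x : {for x, continuous (fun t => expR (- (c * t)))}.
Proof.
by apply/differentiable_continuous/derivable1_diffP; case: (is_derive_expRM c x).
Qed.

Lemma continuous_powR_expR b c x : 0 < x ->
  {for x, continuous (fun t => t `^ b * expR (- (c * t)))}.
Proof.
by move=> x0; apply: continuousM; [exact: continuous_powR|exact: continuous_expRM].
Qed.

Lemma gamma_integral_lty b c : 0 < b -> 0 < c -> (gamma_integral b c < +oo)%E.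
Proof.
move=> b0 c0; have c20 : 0 < c / 2 by rewrite divr_gt0.
have mRpos : measurable Rpos by exact: measurable_itv.
pose K := (b / (c / 2)) `^ b.
apply: (@le_lt_trans _ _ (\int[mu]_(t in Rpos) (K%:E * (expR (- (c / 2 * t)))%:E))%E).
  apply: ge0_le_integral => //.
  - by move=> t _; rewrite lee_fin mulr_ge0 ?powR_ge0 ?expR_ge0.
  - apply/measurable_EFinP; apply: measurable_gt0; exact: measurable_powR_expR.
  - apply/measurable_EFinP; apply: measurable_gt0.
    apply: measurable_funM => //.
    by apply: measurableT_comp => //; apply: measurableT_comp => //;
      exact: measurable_funM.
  - move=> t; rewrite /= in_itv/= andbT => t0; rewrite lee_fin.
    rewrite (_ : - (c * t) = - (c / 2 * t) - (c / 2 * t)); last by field.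
    rewrite expRD mulrA ler_wpM2r ?expR_ge0// expRN ler_pdivrMr ?expR_gt0//.
    exact/powR_le_expR/ltW.
rewrite ge0_integralZl//.
- by rewrite integral_expRM// -EFinM ltry.
- apply/measurable_EFinP; apply: measurable_gt0.
  by apply: measurableT_comp => //; apply: measurableT_comp => //;
    exact: measurable_funM.
- by rewrite lee_fin; exact: powR_ge0.
Qed.

Lemma gamma_integral_fin_num b c : 0 < b -> 0 < c ->
  gamma_integral b c \is a fin_num.
Proof.
by move=> b0 c0; rewrite ge0_fin_numE ?gamma_integral_ge0// gamma_integral_lty.
Qed.

Lemma gamma_integral_gt0 b : 0 < b -> (0 < gamma_integral b 1)%E.
Proof.
move=> b0; apply: (@lt_le_trans _ _ (\int[mu]_(t in `[1%R, 2%R]) (expR (- 2))%:E)%E).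
  rewrite integral_cst//= lebesgue_measure_itv/= lte_fin ltr1n.
  by rewrite -EFinD -EFinM lte_fin mulr_gt0 ?expR_gt0// subr_gt0 ltr1n.
have sub : `[1%R, 2%R] `<=` Rpos.
  by move=> t; rewrite /= !in_itv/= andbT => /andP[/(lt_le_trans ltr01)].
have mf : measurable_fun Rpos (fun t => (t `^ b * expR (- (1 * t)))%:E).
  by apply/measurable_EFinP; apply: measurable_gt0; exact: measurable_powR_expR.
have f0 t : Rpos t -> (0 <= (t `^ b * expR (- (1 * t)))%:E)%E.
  by move=> _; rewrite lee_fin mulr_ge0 ?powR_ge0 ?expR_ge0.
apply: (@le_trans _ _ (\int[mu]_(t in `[1%R, 2%R]) (t `^ b * expR (- (1 * t)))%:E)%E);
  last exact: ge0_subset_integral.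
apply: ge0_le_integral => //.
- exact: measurable_funS mf.
- move=> t; rewrite /= in_itv/= => /andP[t1 t2]; rewrite lee_fin.
  rewrite -[leLHS]mul1r ler_pM ?expR_ge0//.
    suff : 1 `^ b <= t `^ b by rewrite powR1.
    by apply: ge0_ler_powR; rewrite ?nnegrE ?(ltW b0) ?(le_trans ler01 t1).
  by rewrite ler_expR mul1r lerN2.
Qed.

(** The functional equation of Gamma. The derivative of [- t `^ (b + 1) * expR (- t)]
    changes sign, whereas the fundamental theorem of calculus on a half-line is
    about nonnegative integrands; adding the exponential [K * expR (- (2^-1 * t))],
    whose integral is known, restores the sign, and it cancels at the end. *)
Lemma gamma_integral_rec b : 0 < b ->
  gamma_integral (b + 1) 1 = ((b + 1)%:E * gamma_integral b 1)%E.
Proof.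
move=> b0.
have mRpos : measurable Rpos by exact: measurable_itv.
have b10 : 0 < b + 1 by rewrite addr_gt0.
(* With this K the integrand f of the fundamental theorem is nonnegative; see fK. *)
pose K := (b + 1) * (b / 2^-1) `^ b.
have K0 : 0 <= K by rewrite mulr_ge0 ?powR_ge0 ?ltW.
pose f t := t `^ (b + 1) * expR (- (1 * t)) +
  (K * expR (- (2^-1 * t)) - (b + 1) * (t `^ b * expR (- (1 * t)))).
pose F t := - (t `^ (b + 1) * expR (- (1 * t))) - K * 2 * expR (- (2^-1 * t)).
have fK t : 0 <= t ->
    (b + 1) * (t `^ b * expR (- (1 * t))) <= K * expR (- (2^-1 * t)).
  move=> t0; rewrite /K -mulrA ler_wpM2l ?(ltW b10)//.
  rewrite (_ : - (1 * t) = - (2^-1 * t) - (2^-1 * t)); last by field.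
  rewrite expRD mulrA ler_wpM2r ?expR_ge0// expRN ler_pdivrMr ?expR_gt0//.
  by apply: powR_le_expR.
have cpe0 d c : 0 < d -> (t `^ d * expR (- (c * t))) @[t --> 0^'+] -->
     (0 : R) `^ d * expR (- (c * 0)).
  move=> d0; apply: cvgM; first exact: cvg_powR_right0.
  exact/cvg_at_right_filter/continuous_expRM.
have dF x : 0 < x -> is_derive x 1 F (f x).
  move=> x0.
  have h1 := is_deriveN
    (is_deriveM (is_derive1_powR (b + 1) x0) (is_derive_expRM 1 x)).
  have h2 := is_deriveZ (K * 2) (is_derive_expRM 2^-1 x).
  have h3 := is_deriveB h1 h2.
  apply: (is_derive_eq h3).
  by rewrite /GRing.scale/= /f addrK; field.
have F0 : (\int[mu]_(x in Rpos) (f x)%:E = (0 - F 0)%:E)%E.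
  apply: (ge0_FTC_0y _ dF).
  - move=> t t0; apply: addr_ge0; first by rewrite mulr_ge0 ?powR_ge0 ?expR_ge0.
    by rewrite subr_ge0 fK.
  - move=> x x0; apply: continuousD; first exact: continuous_powR_expR.
    apply: continuousB; apply: continuousM; try exact: cst_continuous.
      exact: continuous_expRM.
    exact: continuous_powR_expR.
  - apply: cvgD; first exact: cpe0.
    apply: cvgB; apply: cvgMr; last exact: cpe0.
    exact/cvg_at_right_filter/continuous_expRM.
  - apply: cvgB; first by apply: cvgN; exact: cpe0.
    apply: cvgMr.
    exact/cvg_at_right_filter/continuous_expRM.
  - rewrite -[X in _ --> X](_ : - 0 - K * 2 * 0 = 0); last first.
      by rewrite mulr0 subr0 oppr0.
    apply: cvgB; last by apply: cvgMr; apply: cvg_expRM_0; rewrite invr_gt0.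
    apply: cvgN.
    pose C := ((b + 1) / 2^-1) `^ (b + 1).
    apply: (@squeeze_cvgr _ _ _ _ (cst 0) (fun t => C * expR (- (2^-1 * t))));
      last 2 first.
    + exact: cvg_cst.
    + rewrite -[X in _ --> X](mulr0 C); apply: cvgMr; apply: cvg_expRM_0.
      by rewrite invr_gt0.
    near=> t.
    rewrite mulr_ge0 ?powR_ge0 ?expR_ge0//=.
    rewrite (_ : - (1 * t) = - (2^-1 * t) - (2^-1 * t)); last by field.
    rewrite expRD mulrA ler_wpM2r ?expR_ge0// expRN ler_pdivrMr ?expR_gt0//.
    by apply: powR_le_expR.
have mper d c : measurable_fun Rpos (fun t => t `^ d * expR (- (c * t))).
  by apply: measurable_gt0; exact: measurable_powR_expR.
have mpe d c : measurable_fun Rpos (EFin \o (fun t => t `^ d * expR (- (c * t)))).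
  by apply/measurable_EFinP; exact: mper.
have mexp : measurable_fun Rpos (EFin \o (fun t => K * expR (- (2^-1 * t)))).
  apply/measurable_EFinP; apply: measurable_gt0; apply: measurable_funM => //.
  by apply: measurableT_comp => //; apply: measurableT_comp => //;
    exact: measurable_funM.
have : (\int[mu]_(x in Rpos) (f x)%:E + (b + 1)%:E * gamma_integral b 1 =
  gamma_integral (b + 1) 1 + \int[mu]_(x in Rpos) (K * expR (- (2^-1 * x)))%:E)%E.
  rewrite /gamma_integral -ge0_integralZl//; last 2 first.
  - by move=> t _; rewrite lee_fin mulr_ge0 ?powR_ge0 ?expR_ge0.
  - by rewrite lee_fin ltW.
  rewrite -!ge0_integralD//.
  - by apply: eq_integral => t _; rewrite -!EFinM -!EFinD; congr EFin; rewrite /f; ring.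
  - by move=> t _; rewrite lee_fin mulr_ge0 ?powR_ge0 ?expR_ge0.
  - exact: mpe.
  - by move=> t _; rewrite lee_fin mulr_ge0 ?expR_ge0.
  - move=> t; rewrite /= in_itv/= andbT => t0; rewrite lee_fin addr_ge0//.
      by rewrite mulr_ge0 ?powR_ge0 ?expR_ge0.
    by rewrite subr_ge0 fK// ltW.
  - apply/measurable_EFinP; apply: measurable_funD; first exact: mper.
    apply: measurable_funB; first by apply/measurable_EFinP.
    by apply: measurable_funM => //; exact: mper.
  - move=> t _; rewrite -EFinM lee_fin mulr_ge0 ?(ltW b10)//.
    by rewrite mulr_ge0 ?powR_ge0 ?expR_ge0.
  - by apply: measurable_funeM; exact: mpe.
  - exact: mpe.
have -> : (\int[mu]_(x in Rpos) (K * expR (- (2^-1 * x)))%:E = (K * 2)%:E)%E.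
  under eq_integral do rewrite EFinM.
  rewrite ge0_integralZl//.
  - by rewrite integral_expRM ?invr_gt0// invrK.
  - apply/measurable_EFinP; apply: measurable_gt0.
    by apply: measurableT_comp => //; apply: measurableT_comp => //;
      exact: measurable_funM.
rewrite F0 /F powR0 ?gt_eqF// mul0r mulr0 !oppr0 expR0 mulr1 sub0r opprB subr0.
rewrite [RHS]addeC.
rewrite -(fineK (gamma_integral_fin_num b0 ltr01)).
rewrite -(fineK (gamma_integral_fin_num b10 ltr01)) -EFinM -!EFinD.
by move=> [/addrI ->].
Unshelve. all: by end_near. Qed.

(** The change of variables [t |-> c * t]. *)
Lemma gamma_integral_scale b c : 0 < b -> 0 < c ->
  gamma_integral b c = ((c `^ (- (b + 1)))%:E * gamma_integral b 1)%E.
Proof.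
move=> b0 c0.
pose G t := t `^ b * expR (- (1 * t)).
have mRpos : measurable Rpos by exact: measurable_itv.
have mG : measurable_fun Rpos (EFin \o G).
  by apply/measurable_EFinP; apply: measurable_gt0; exact: measurable_powR_expR.
have mGc : measurable_fun Rpos (EFin \o (fun t => t `^ b * expR (- (c * t)))).
  by apply/measurable_EFinP; apply: measurable_gt0; exact: measurable_powR_expR.
have dM x : is_derive x 1 ( *%R c) c.
  have := is_deriveZ c (is_derive_id x 1).
  by rewrite /GRing.scale/= mulr1.
have dMc : ( *%R c : R -> R)^`()%classic = cst c.
  by apply/funext => x; rewrite derive1E; case: (dM x).
have -> : gamma_integral b 1 = (\int[mu]_(x in `[(c * 0)%R, +oo[) (G x)%:E)%E.
  by rewrite mulr0 -integral_itv_obnd_cbnd.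
rewrite (@increasing_ge0_integration_by_substitutiony _ ( *%R c))//.
- rewrite -integral_itv_obnd_cbnd; last first.
    apply/measurable_EFinP; rewrite dMc; apply: measurable_funM => //.
    apply: measurable_gt0; apply: measurableT_comp; first exact: measurable_powR_expR.
    exact: measurable_funM.
  rewrite -ge0_integralZl//.
  + rewrite dMc; apply: eq_integral => t; rewrite in_gt0_itv => t0.
    rewrite -EFinM; congr EFin.
    change (t `^ b * expR (- (c * t)) =
      c `^ (- (b + 1)) * ((c * t) `^ b * expR (- (1 * (c * t))) * c)).
    rewrite mul1r powRM ?(ltW c0) ?(ltW t0)// powRN powRD ?powRr1 ?(ltW c0)//;
      last first.
      by rewrite (gt_eqF c0) implybT.
    by field; rewrite (gt_eqF c0) gt_eqF// powR_gt0.
  + apply/measurable_EFinP; rewrite dMc; apply: measurable_funM => //.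
    apply: measurable_gt0; apply: measurableT_comp; first exact: measurable_powR_expR.
    exact: measurable_funM.
  + move=> t _; rewrite dMc lee_fin mulr_ge0 ?(ltW c0)//.
    by rewrite mulr_ge0 ?powR_ge0 ?expR_ge0.
  + by rewrite lee_fin powR_ge0.
- by move=> x y _ _; rewrite ltr_pM2l.
- by rewrite dMc => x _; exact: cst_continuous.
- by rewrite dMc; exact: is_cvg_cst.
- by rewrite dMc; exact: is_cvg_cst.
- split.
    by move=> x _; case: (dM x).
  by apply/cvg_at_right_filter; apply: cvgMr.
- exact: gt0_cvgMry.
- apply/continuous_within_itvcyP; rewrite mulr0 /G; split.
    by move=> x; rewrite in_itv/= andbT; exact: continuous_powR_expR.
  apply: cvgM; first exact: cvg_powR_right0.
  exact/cvg_at_right_filter/continuous_expRM.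
- by move=> x _; rewrite mulr_ge0 ?powR_ge0 ?expR_ge0.
Qed.

End GammaIntegral.

(** * Polylogarithms on the unit interval *)

Section Polylog.
Variable R : realType.
Implicit Types (x y t u : R) (k n N : nat).

Lemma sum_deriv_geometric x N : 0 <= x < 1 ->
  \sum_(0 <= i < N) i.+1%:R * x ^+ i <= (1 - x) ^- 2.
Proof.
move=> /andP[x0 x1].
have x10 : 0 < 1 - x by rewrite subr_gt0.
rewrite -[leRHS]mul1r ler_pdivlMr ?exprn_gt0//.
have : (\sum_(0 <= i < N) i.+1%:R * x ^+ i) * (1 - x) ^+ 2
    = 1 - (1 + N%:R * (1 - x)) * x ^+ N.
  elim: N => [|N IH]; first by rewrite big_geq// mul0r; ring.
  rewrite big_nat_recr//= mulrDl IH [in RHS]exprS -natr1.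
  by ring.
move=> ->; rewrite gerBl mulr_ge0 ?exprn_ge0// addr_ge0// mulr_ge0//.
exact: ltW.
Qed.

Lemma is_cvg_pseries_bounded (a : nat -> R) x : 0 <= x < 1 ->
  (forall n, 0 <= a n <= n.+1%:R) -> cvgn (pseries a x).
Proof.
move=> x01 a0; have /andP[x0 x1] := x01; apply: nondecreasing_is_cvgn.
  apply/nondecreasing_seqP => n; rewrite /pseries /series/= big_nat_recr//=.
  by rewrite lerDl mulr_ge0 ?exprn_ge0//; case/andP: (a0 n).
exists ((1 - x) ^- 2) => _ [N _ <-].
apply: le_trans (sum_deriv_geometric N x01).
by apply: ler_sum => i _; rewrite ler_wpM2r ?exprn_ge0//; case/andP: (a0 i).
Qed.

(** Valid also when the sequence diverges, since [limn] only depends on the set of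
    limits; so functions defined by a limit can be rewritten at every argument. *)
Lemma limn_shiftS (v : nat -> R) : limn v = limn (fun n => v n.+1).
Proof.
rewrite /lim; congr get; apply/funext => l; apply/propext.
by rewrite -[v @ \oo --> l]cvg_shiftS.
Qed.

Definition invn_pow k n : R := (n.+1%:R ^+ k)^-1.

Lemma invn_pow_bound k n : 0 <= invn_pow k n <= 1.
Proof.
rewrite /invn_pow invr_ge0 exprn_ge0//= invf_le1 ?exprn_gt0//.
by rewrite exprn_ege1// ler1n.
Qed.

(** The power series of [polylog k x / x]; it is also the derivative of
    [polylog k.+1] at [x], including at [x = 0]. *)
Definition polylog_div k x : R := limn (pseries (invn_pow k) x).

Lemma is_cvg_polylog_div k x : 0 <= x < 1 -> cvgn (pseries (invn_pow k) x).
Proof.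
move=> x01; apply: is_cvg_pseries_bounded => // n.
have /andP[-> /= /le_trans] := invn_pow_bound k n; apply.
by rewrite ler1n.
Qed.

Lemma polylog_seriesE k x :
  series (fun m => x ^+ m.+1 / m.+1%:R ^+ k) = (fun N => x * pseries (invn_pow k) x N).
Proof.
apply/funext => N; rewrite /pseries /series/= mulr_sumr.
by apply: eq_bigr => i _; rewrite exprS /invn_pow mulrAC mulrA.
Qed.

Lemma cvg_polylog k x : 0 <= x < 1 ->
  series (fun m => x ^+ m.+1 / m.+1%:R ^+ k) @ \oo --> polylog k x.
Proof.
move=> x01; suff : cvgn (series (fun m => x ^+ m.+1 / m.+1%:R ^+ k)) by [].
rewrite polylog_seriesE; apply: is_cvgMr; exact: is_cvg_polylog_div.
Qed.

Lemma polylogE k x : 0 <= x < 1 -> polylog k x = x * polylog_div k x.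
Proof.
move=> x01; rewrite /polylog polylog_seriesE; apply/cvg_lim => //.
by apply: cvgMr; exact: is_cvg_polylog_div.
Qed.

(** Termwise differentiation: the coefficient of [x ^+ n.+1] in [polylog k.+1],
    times [n.+1], is the coefficient of [x ^+ n] in [polylog_div k]. *)
Lemma is_derive_polylog k x : 0 <= x < 1 ->
  is_derive x 1 (polylog k.+1) (polylog_div k x).
Proof.
move=> /andP[x0 x1].
pose c n : R := if n is m.+1 then invn_pow k.+1 m else 0.
have dc : pseries_diffs c = invn_pow k.
  apply/funext => n; rewrite /pseries_diffs /c /invn_pow exprS invfM mulrA.
  by rewrite mulfV ?mul1r.
have -> : polylog k.+1 = (fun x => limn (pseries c x)).
  apply/funext => y; rewrite [RHS]limn_shiftS /polylog; congr (limn _).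
  apply/funext => N; rewrite /pseries /series/= big_nat_recl//= mul0r add0r.
  by apply: eq_bigr => i _; rewrite mulrC.
rewrite /polylog_div -dc.
pose K := (1 + x) / 2.
have K01 : 0 <= K < 1 by rewrite /K; apply/andP; split; lra.
apply: (@pseries_snd_diffs R c K x).
- apply: is_cvg_pseries_bounded => // -[|n]; first by rewrite lexx ler0n.
  by have /andP[-> /= /le_trans] := invn_pow_bound k.+1 n; apply; rewrite ler1n.
- by rewrite dc; exact: is_cvg_polylog_div.
- apply: is_cvg_pseries_bounded => // n; rewrite dc /pseries_diffs.
  have /andP[h0 h1] := invn_pow_bound k n.+1.
  by rewrite mulr_ge0//= ler_piMr.
- by rewrite !ger0_norm// ?(proj1 (andP K01)) /K//; lra.
Qed.

Lemma polylog_ge_partial k x N : 0 <= x < 1 ->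
  \sum_(0 <= m < N) x ^+ m.+1 / m.+1%:R ^+ k <= polylog k x.
Proof.
move=> x01; have /andP[x0 _] := x01.
have nd : nondecreasing_seq (series (fun m => x ^+ m.+1 / m.+1%:R ^+ k)).
  apply/nondecreasing_seqP => n; rewrite /series/= big_nat_recr//= lerDl.
  by rewrite divr_ge0 ?exprn_ge0.
exact: (nondecreasing_cvgn_le nd (cvgP _ (cvg_polylog x01)) N).
Qed.

Lemma polylog_ge0 k x : 0 <= x < 1 -> 0 <= polylog k x.
Proof. by move=> /(@polylog_ge_partial k x 0); rewrite big_geq. Qed.

Lemma polylog_le_cvg k x (l : R) : 0 <= x < 1 ->
  (forall N, \sum_(0 <= m < N) x ^+ m.+1 / m.+1%:R ^+ k <= l) -> polylog k x <= l.
Proof. by move=> x01 h; apply: limr_le; [exact: cvg_polylog|near=> N; exact: h].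
Unshelve. all: by end_near. Qed.

Lemma polylog0 x : 0 <= x < 1 -> polylog 0 x = x / (1 - x).
Proof.
move=> /andP[x0 x1]; apply/cvg_lim => //.
have -> : series (fun m => x ^+ m.+1 / m.+1%:R ^+ 0) = series (geometric x x).
  by congr series; apply/funext => m; rewrite expr0 divr1 /= exprS.
by apply: cvg_geometric_series; rewrite ger0_norm.
Qed.

Lemma polylog_le_polylog0 k x : 0 <= x < 1 -> polylog k x <= polylog 0 x.
Proof.
move=> x01; have /andP[x0 x1] := x01; apply: polylog_le_cvg => // N.
apply: le_trans (@polylog_ge_partial 0 x N x01).
apply: ler_sum => i _; rewrite expr0 divr1 ler_pdivrMr ?exprn_gt0//.
by rewrite ler_peMr ?exprn_ge0// exprn_ege1// ler1n.
Qed.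

Lemma polylog_div0 x : 0 <= x < 1 -> polylog_div 0 x = (1 - x)^-1.
Proof.
move=> /andP[x0 x1]; rewrite /polylog_div; apply/cvg_lim => //.
have -> : pseries (invn_pow 0) x = series (geometric 1 x).
  by congr series; apply/funext => m; rewrite /= /invn_pow expr0 invr1.
by rewrite -[X in _ --> X]mul1r; apply: cvg_geometric_series; rewrite ger0_norm.
Qed.

End Polylog.

(** * The reflection formula of the dilogarithm *)

Section Dilog.
Variable R : realType.
Implicit Types (x y t u : R) (k n N : nat).

Lemma derive0_eq (f : R -> R) (a b : R) : a <= b ->
  (forall x, a <= x <= b -> is_derive x 1 f 0) -> f a = f b.
Proof.
rewrite le_eqVlt => /predU1P[->//|ab] df.
have dfi x : x \in `]a, b[ -> is_derive x 1 f 0.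
  by rewrite in_itv/= => /andP[ax xb]; apply: df; rewrite !ltW.
have [|c _] := @MVT _ f (fun=> 0) a b ab dfi.
  apply: derivable_within_continuous => x; rewrite in_itv/= => xab.
  by case: (df x xab).
by rewrite mul0r => /eqP; rewrite subr_eq0 => /eqP.
Qed.

Lemma is_derive_expRN t : is_derive t 1 (fun t => expR (- t)) (- expR (- t)).
Proof.
have := is_derive_expRM 1 t; rewrite mulN1r mul1r.
by under eq_fun do rewrite mul1r.
Qed.

Lemma is_derive_onem_expRN t :
  is_derive t 1 (fun t => 1 - expR (- t)) (expR (- t)).
Proof.
have := is_deriveB (is_derive_cst (1 : R) t 1) (is_derive_expRN t).
by rewrite sub0r opprK.
Qed.

Lemma expRN_itv t : 0 < t -> 0 <= expR (- t) < 1.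
Proof. by move=> t0; rewrite expR_ge0/= expR_lt1 oppr_lt0. Qed.

Lemma onem_expRN_itv t : 0 <= t -> 0 <= 1 - expR (- t) < 1.
Proof.
by move=> t0; rewrite subr_ge0 expR_le1 oppr_le0 t0/= gtrBl expR_gt0.
Qed.

(** Both sides have derivative 1 and vanish at 0; this is [Li_1 (x) = - ln (1 - x)]
    without the logarithm. *)
Lemma polylog1_onem_expRN t : 0 <= t -> polylog 1 (1 - expR (- t)) = t.
Proof.
move=> t0; apply/eqP; rewrite -subr_eq0; apply/eqP.
have h x : 0 <= x <= t ->
    is_derive x 1 (fun x => polylog 1 (1 - expR (- x)) - x) 0.
  move=> /andP[x0 _].
  have h1 := @is_derive1_comp R (polylog 1) (fun x => 1 - expR (- x)) x
    _ _ (is_derive_polylog 0 (onem_expRN_itv x0)) (is_derive_onem_expRN x).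
  apply: (is_derive_eq (is_deriveB h1 (is_derive_id x 1))).
  rewrite polylog_div0 ?onem_expRN_itv// subKr mulVf ?subrr//.
  by rewrite gt_eqF ?expR_gt0.
rewrite -(derive0_eq t0 h) /= oppr0 expR0 subrr addr0.
by rewrite polylogE ?mul0r// lexx ltr01.
Qed.

(** The left-hand side of Euler's reflection formula for the dilogarithm at
    [x = expR (- t)], where [t * polylog 1 (expR (- t))] is [ln x * ln (1 - x)]. *)
Definition dilog_sum t : R := polylog 2 (1 - expR (- t)) +
  (polylog 2 (expR (- t)) + t * polylog 1 (expR (- t))).

(** With [q = expR (- t)], the first term contributes
    [q / (1 - q) * polylog 1 (1 - q) = t * q / (1 - q)] to the derivative, which
    cancels the contribution of [t * polylog_div 0 q]; the two others are opposite. *)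
Lemma dilog_sum_cst t u : 0 < t -> t <= u -> dilog_sum t = dilog_sum u.
Proof.
move=> t0 tu; apply: derive0_eq => // x /andP[tx _].
have x0 : 0 < x by apply: lt_le_trans tx.
have q01 := expRN_itv x0; have p01 := onem_expRN_itv (ltW x0).
have h1 := @is_derive1_comp R (polylog 2) (fun x => 1 - expR (- x)) x
    _ _ (is_derive_polylog 1 p01) (is_derive_onem_expRN x).
have h2 := @is_derive1_comp R (polylog 2) (fun x => expR (- x)) x
    _ _ (is_derive_polylog 1 q01) (is_derive_expRN x).
have h3 := @is_derive1_comp R (polylog 1) (fun x => expR (- x)) x
    _ _ (is_derive_polylog 0 q01) (is_derive_expRN x).
have h4 := is_deriveM (is_derive_id x 1) h3.
apply: (is_derive_eq (is_deriveD h1 (is_deriveD h2 h4))).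
rewrite /GRing.scale/= polylog_div0// (polylogE 1 q01).
have := polylog1_onem_expRN (ltW x0).
have q1 : 1 - expR (- x) != 0.
  by rewrite gt_eqF// subr_gt0; case/andP: q01.
rewrite (polylogE 1 p01) => /(canRL (mulKf q1)) ->.
by field.
Qed.

Lemma invr_expR_sub1_le t : 0 < t -> (expR t - 1)^-1 <= 2 / t ^+ 2.
Proof.
move=> t0; have := expR_ge1Dxn 1 (ltW t0).
rewrite -lerBrDl => h.
rewrite -[2]invrK -invfM lef_pV2 ?qualifE/= ?subr_gt0 ?expR_gt1//.
  by rewrite mulrC.
by rewrite mulr_gt0 ?exprn_gt0.
Qed.

Lemma polylog0_expRN t : 0 < t -> polylog 0 (expR (- t)) = (expR t - 1)^-1.
Proof.
move=> t0; rewrite polylog0 ?expRN_itv// expRN.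
have : expR t - 1 != 0 by rewrite gt_eqF// subr_gt0 expR_gt1.
have : expR t != 0 by rewrite gt_eqF// expR_gt0.
by move=> h1 h2; field; rewrite h1 h2.
Qed.

(** The partial sums are at most [2], by comparison with the telescoping series of
    general term [1 / z - 1 / (z + 1)]. *)
Lemma cvg_polylog2_1 :
  series (fun m => (1 : R) ^+ m.+1 / m.+1%:R ^+ 2) @ \oo --> polylog 2 (1 : R).
Proof.
suff : cvgn (series (fun m => (1 : R) ^+ m.+1 / m.+1%:R ^+ 2)) by [].
apply: nondecreasing_is_cvgn.
  apply/nondecreasing_seqP => n; rewrite /series/= big_nat_recr//= lerDl.
  by rewrite divr_ge0 ?exprn_ge0.
exists 2 => _ [N _ <-]; rewrite /series/=.
case: N => [|N]; first by rewrite big_geq.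
suff : \sum_(0 <= m < N.+1) 1 ^+ m.+1 / m.+1%:R ^+ 2 <= 2 - (N.+1%:R)^-1 :> R.
  by move=> /le_trans; apply; rewrite gerBl invr_ge0.
elim: N => [|N IH]; first by rewrite big_nat1 !expr1n divr1 invr1; lra.
rewrite big_nat_recr//=; apply: (le_trans (lerD IH (lexx _))).
rewrite expr1n mul1r.
have -> : N.+2%:R = N.+1%:R + 1 :> R by rewrite natr1.
have : 0 < (N.+1%:R : R) by [].
move: (N.+1%:R : R) => z z0; have z10 : 0 < z + 1 by rewrite addr_gt0.
rewrite -subr_ge0.
have -> : 2 - (z + 1)^-1 - (2 - z^-1 + ((z + 1) ^+ 2)^-1) = (z * (z + 1) ^+ 2)^-1.
  by field; rewrite !gt_eqF.
by rewrite invr_ge0 mulr_ge0 ?exprn_ge0 ?ltW.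
Qed.

Lemma polylog2_le x : 0 <= x < 1 -> polylog 2 x <= polylog 2 1.
Proof.
move=> x01; have /andP[x0 x1] := x01; apply: polylog_le_cvg => // N.
apply: le_trans (nondecreasing_cvgn_le _ (cvgP _ cvg_polylog2_1) N).
  apply: ler_sum => i _; rewrite ler_wpM2r ?invr_ge0 ?exprn_ge0//.
  by rewrite lerXn2r ?qualifE/= ?ler01// ltW.
apply/nondecreasing_seqP => n; rewrite /series/= big_nat_recr//= lerDl.
by rewrite divr_ge0 ?exprn_ge0.
Qed.

(** The constant value is found by letting [u] go to infinity in [dilog_sum u]: it
    is at most [polylog 2 1 + 4 / u] for [u >= 1], and at least every partial sum of
    [polylog 2] at [1 - expR (- u)], hence at [1]. *)
Lemma dilog_reflection t : 0 < t ->
  polylog 2 (1 - expR (- t)) +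
  (polylog 2 (expR (- t)) + t * polylog 1 (expR (- t))) = polylog 2 1.
Proof.
move=> t0; rewrite -/(dilog_sum t); apply/eqP; rewrite eq_le; apply/andP; split.
  apply/ler_addgt0Pr => e e0.
  pose u := Num.max t (Num.max 1 (4 / e)).
  have tu : t <= u by rewrite le_max lexx.
  have u1 : 1 <= u by rewrite !le_max lexx orbT.
  have ue : 4 / e <= u by rewrite !le_max lexx !orbT.
  have u0 : 0 < u by apply: lt_le_trans u1.
  have q01 := expRN_itv u0.
  rewrite (dilog_sum_cst t0 tu) /dilog_sum.
  apply: lerD; first exact/polylog2_le/onem_expRN_itv/ltW.
  apply: (@le_trans _ _ ((1 + u) * (2 / u ^+ 2))).
    rewrite mulrDl mul1r.
    have h k : polylog k (expR (- u)) <= 2 / u ^+ 2.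
      apply: (le_trans (polylog_le_polylog0 k q01)).
      by rewrite polylog0_expRN// invr_expR_sub1_le.
    by rewrite lerD// ler_wpM2l// ltW.
  rewrite mulrA ler_pdivrMr ?exprn_gt0//.
  move: ue; rewrite ler_pdivrMr// => ue.
  have h1 : 0 <= (u * e - 4) * u by apply: mulr_ge0; [rewrite subr_ge0|exact: ltW].
  by rewrite expr2; nra.
apply: limr_le; first exact: (cvgP _ cvg_polylog2_1).
apply: nearW => N; rewrite /series/=.
(* A partial sum at 1 is the limit of the partial sums at 1 - expR (- u). *)
pose S x := \sum_(0 <= m < N) x ^+ m.+1 / m.+1%:R ^+ 2 : R.
have cS : S (1 - expR (- u)) @[u --> +oo] --> S 1.
  have cp : continuous (fun x => S x).
    rewrite /S; elim: N {S} => [|N IH] x.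
      by under eq_fun do rewrite big_geq//; exact: cst_continuous.
    rewrite (_ : (fun _ => _) = (fun y => \sum_(0 <= m < N) y ^+ m.+1 / m.+1%:R ^+ 2) +
        (fun y => y ^+ N.+1 / N.+1%:R ^+ 2)); last first.
      by apply/funext => y; rewrite big_nat_recr.
    apply: continuousD; first exact: IH.
    by apply: continuousM; [exact: exprn_continuous|exact: cst_continuous].
  apply: continuous_cvg; first exact: cp.
  rewrite -[X in _ --> X]subr0; apply: cvgB; first exact: cvg_cst.
  exact: cvgr_expR.
apply: (cvgr_to_le cS).
near=> u.
have tu : t <= u by near: u; apply: nbhs_pinfty_ge; exact: num_real.
have u0 : 0 < u by apply: lt_le_trans tu.
rewrite (dilog_sum_cst t0 tu) /dilog_sum.
apply: (le_trans (@polylog_ge_partial _ 2 _ N (onem_expRN_itv (ltW u0)))).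
rewrite lerDl addr_ge0 ?polylog_ge0 ?expRN_itv// mulr_ge0 ?(ltW u0)//.
by rewrite polylog_ge0 ?expRN_itv.
Unshelve. all: by end_near. Qed.

End Dilog.

(** * Integrability of products of polylogarithms *)

Section MTIntegral.
Variable R : realType.
Implicit Types (a b c t : R) (k n N : nat) (ks : seq nat).
Local Notation mu := (@lebesgue_measure R).
Local Notation Rpos := (`]0%R, +oo[%classic : set R).

(** [expR t - 1 >= (t / 2) * expR (t / 2)]: one bound that shows both the simple
    pole at 0 and the exponential decay, so that powers of it are dominated by
    integrands of [gamma_integral]. *)
Lemma invr_expR_sub1_le_expR t : 0 < t ->
  (expR t - 1)^-1 <= 2 * expR (- (2^-1 * t)) / t.
Proof.
move=> t0; set v := expR (2^-1 * t).
have v0 : 0 < v by exact: expR_gt0.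
have tE : expR t = v ^+ 2.
  by rewrite expr2 -expRD; congr expR; field.
have v1 : 1 + 2^-1 * t <= v by exact: expR_ge1Dx.
have h : t * v <= 2 * (v ^+ 2 - 1).
  suff : 0 <= v * (v - 2^-1 * t - 1) + (v - 1) by lra.
  by apply: addr_ge0; [apply: mulr_ge0; [exact: ltW|lra]|nra].
have v21 : 0 < v ^+ 2 - 1 by rewrite -tE subr_gt0 expR_gt1.
rewrite tE expRN -/v -mulrA -invfM -[X in X * _]invrK -invfM.
by rewrite lef_pV2 ?qualifE/= ?mulr_gt0//; lra.
Qed.

Definition polylog_prod ks t : R := \prod_(k <- ks) polylog k (expR (- t)).

Lemma polylog_prod_ge0 ks t : 0 < t -> 0 <= polylog_prod ks t.
Proof.
by move=> t0; apply: prodr_ge0 => k _; rewrite polylog_ge0// expRN_itv.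
Qed.

Lemma polylog_prod_le ks t : 0 < t ->
  polylog_prod ks t <= (expR t - 1)^-1 ^+ size ks.
Proof.
move=> t0; elim: ks => [|k ks IH]; first by rewrite /polylog_prod big_nil.
rewrite {1}/polylog_prod big_cons/= exprS ler_pM//.
- by rewrite polylog_ge0// expRN_itv.
- exact: polylog_prod_ge0.
- by rewrite -polylog0_expRN// polylog_le_polylog0// expRN_itv.
Qed.

Lemma measurable_polylog_expRN k :
  measurable_fun Rpos (fun t => polylog k (expR (- t))).
Proof.
apply: (@measurable_fun_cvg _ _ _ _ (fun N t =>
   series (fun m => expR (- t) ^+ m.+1 / m.+1%:R ^+ k) N)) => //.
- move=> N; rewrite /series/=.
  apply: measurable_sum => m; apply: measurable_funM => //.
  apply: measurable_funX; apply: measurable_gt0.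
  by apply: measurableT_comp => //; exact: measurableT_comp.
- move=> t; rewrite /= in_itv/= andbT => t0.
  by apply: cvg_polylog; exact: expRN_itv.
Qed.

Lemma measurable_polylog_prod ks : measurable_fun Rpos (polylog_prod ks).
Proof.
by apply: measurable_prod => k _; exact: measurable_polylog_expRN.
Qed.

Lemma integral_polylog_prod_lty b ks : (0 < size ks)%N -> (size ks)%:R < b ->
  (\int[mu]_(t in Rpos) (t `^ b * polylog_prod ks t)%:E < +oo)%E.
Proof.
move=> n0 nb; set n := size ks in n0 nb *.
have mRpos : measurable Rpos by exact: measurable_itv.
have c0 : 0 < (n%:R / 2 : R) by rewrite divr_gt0// ltr0n.
apply: (@le_lt_trans _ _ ((2 ^+ n)%:E * gamma_integral (b - n%:R) (n%:R / 2))%E).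
  rewrite /gamma_integral -ge0_integralZl//; last 2 first.
  - by apply/measurable_EFinP; apply: measurable_gt0; exact: measurable_powR_expR.
  - by move=> t _; rewrite lee_fin mulr_ge0 ?powR_ge0 ?expR_ge0.
  apply: ge0_le_integral => //.
  - move=> t; rewrite /= in_itv/= andbT => t0.
    by rewrite lee_fin mulr_ge0 ?powR_ge0 ?polylog_prod_ge0.
  - apply/measurable_EFinP; apply: measurable_funM.
      by apply: measurable_gt0; exact: measurable_powR.
    exact: measurable_polylog_prod.
  - apply: measurable_funeM; apply/measurable_EFinP; apply: measurable_gt0.
    exact: measurable_powR_expR.
  - move=> t; rewrite /= in_itv/= andbT => t0; rewrite -EFinM lee_fin.
    have : polylog_prod ks t <= (2 * expR (- (2^-1 * t)) / t) ^+ n.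
      apply: (le_trans (polylog_prod_le ks t0)).
      rewrite lerXn2r ?qualifE/= ?invr_expR_sub1_le_expR//.
        by rewrite invr_ge0 subr_ge0 ltW// expR_gt1.
      by rewrite divr_ge0 ?mulr_ge0 ?expR_ge0// ltW.
    move=> /(ler_wpM2l (powR_ge0 t b))/le_trans; apply.
    rewrite powRB ?(gt_eqF t0) ?implybT// powR_mulrn ?(ltW t0)//.
    rewrite !exprMn exprVn -expRM_natl.
    have -> : n%:R * - (2^-1 * t) = - (n%:R / 2 * t) by field.
    by rewrite le_eqVlt; apply/orP; left; apply/eqP; ring.
have := @gamma_integral_fin_num R (b - n%:R) (n%:R / 2).
rewrite subr_gt0 => /(_ nb c0)/fineK <-.
by rewrite -EFinM ltry.
Qed.

Lemma integrable_polylog_prod b ks : (0 < size ks)%N -> (size ks)%:R < b ->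
  mu.-integrable Rpos (EFin \o (fun t => t `^ b * polylog_prod ks t)).
Proof.
move=> n0 nb; apply/integrableP; split.
  apply/measurable_EFinP; apply: measurable_funM.
    by apply: measurable_gt0; exact: measurable_powR.
  exact: measurable_polylog_prod.
apply: le_lt_trans (integral_polylog_prod_lty n0 nb).
rewrite le_eqVlt; apply/orP; left; apply/eqP; apply: eq_integral.
move=> t; rewrite in_gt0_itv => t0.
by rewrite /= ger0_norm// mulr_ge0 ?powR_ge0 ?polylog_prod_ge0.
Qed.

End MTIntegral.

(** * Box sums of the Mordell-Tornheim series *)

Section BoxSums.
Variable R : realType.
Implicit Types (a b c t : R) (k n N : nat) (ks : seq nat).
Local Notation mu := (@lebesgue_measure R).
Local Notation Rpos := (`]0%R, +oo[%classic : set R).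

(** The general term of the Mordell-Tornheim series with last exponent [b + 1], the
    exponent that pairs with [t `^ b] under the integral; [f] counts from 0. *)
Definition mt_term ks b (f : 'I_(size ks) -> nat) : R :=
  (\prod_(i < size ks) (f i).+1%:R ^+ nth 0%N ks i)^-1 *
  (\sum_(i < size ks) (f i).+1)%N%:R `^ (- (b + 1)).

Lemma mt_term_ge0 ks b f : 0 <= @mt_term ks b f.
Proof.
by rewrite mulr_ge0 ?powR_ge0// invr_ge0 prodr_ge0// => i _; rewrite exprn_ge0.
Qed.

Definition polylog_partial k N t : R :=
  \sum_(m < N) expR (- t) ^+ m.+1 / m.+1%:R ^+ k.

Definition polylog_partial_prod ks N t : R :=
  \prod_(i < size ks) polylog_partial (nth 0%N ks i) N t.

Lemma polylog_partial_ge0 k N t : 0 <= polylog_partial k N t.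
Proof.
by apply: sumr_ge0 => i _; rewrite divr_ge0 ?exprn_ge0 ?expR_ge0.
Qed.

(** Expanding the product of [size ks] sums gives one term for each choice [f] of a
    summand in every factor, and the exponentials multiply to one exponential of the
    sum of the chosen indices. *)
Lemma polylog_partial_prodE ks N b t :
  t `^ b * polylog_partial_prod ks N t =
  \sum_(f : {ffun 'I_(size ks) -> 'I_N})
    (\prod_(i < size ks) (f i).+1%:R ^+ nth 0%N ks i)^-1 *
    (t `^ b * expR (- ((\sum_(i < size ks) (f i).+1)%N%:R * t))).
Proof.
rewrite /polylog_partial_prod /polylog_partial bigA_distr_bigA/= mulr_sumr.
apply: eq_bigr => f _; rewrite mulrCA; congr (_ * _).
rewrite big_split/= -prodfV mulrC; congr (_ * _).
rewrite natr_sum mulr_suml -sumrN expR_sum; apply: eq_bigr => i _.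
by rewrite -expRM_natl mulrN.
Qed.

Lemma integral_polylog_partial_prod ks N b : (0 < size ks)%N -> 0 < b ->
  (\int[mu]_(t in Rpos) (t `^ b * polylog_partial_prod ks N t)%:E =
   (\sum_(f : {ffun 'I_(size ks) -> 'I_N}) @mt_term ks b (fun i => f i))%:E *
   gamma_integral b 1)%E.
Proof.
move=> n0 b0.
have mRpos : measurable Rpos by exact: measurable_itv.
under eq_integral do rewrite polylog_partial_prodE -sumEFin.
have C0 (f : {ffun 'I_(size ks) -> 'I_N}) :
    0 <= (\prod_(i < size ks) (f i).+1%:R ^+ nth 0%N ks i)^-1 :> R.
  by rewrite invr_ge0 prodr_ge0// => i _; rewrite exprn_ge0.
have mpe c : measurable_fun Rpos (fun t => (t `^ b * expR (- (c * t)))%:E).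
  by apply/measurable_EFinP; apply: measurable_gt0; exact: measurable_powR_expR.
rewrite ge0_integral_sum//; last 2 first.
- move=> f; apply/measurable_EFinP; apply: measurable_funM => //.
  by apply: measurable_gt0; exact: measurable_powR_expR.
- move=> f t _.
  by rewrite lee_fin mulr_ge0// mulr_ge0 ?powR_ge0 ?expR_ge0.
rewrite -sumEFin ge0_sume_distrl; last first.
  by move=> f _; rewrite lee_fin mt_term_ge0.
apply: eq_bigr => f _; rewrite /mt_term; set M := (\sum_(i < _) _)%N.
have M0 : 0 < M%:R :> R.
  rewrite ltr0n /M; case: (size ks) n0 f {C0 M} => // n _ f.
  by rewrite big_ord_recl.
rewrite EFinM -muleA -gamma_integral_scale// /gamma_integral.
under eq_integral do rewrite EFinM.
apply: ge0_integralZl => //.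
- exact: mpe.
- by move=> t _; rewrite lee_fin mulr_ge0 ?powR_ge0 ?expR_ge0.
- by rewrite lee_fin C0.
Qed.

(** Over a box the sum is a finite one, so it can be exchanged with the integral
    at once; monotone convergence then takes care of the growing boxes. *)
Lemma cvg_box_sum ks b : (0 < size ks)%N -> (size ks)%:R < b ->
  \sum_(f : {ffun 'I_(size ks) -> 'I_N}) @mt_term ks b (fun i => f i)
    @[N --> \oo] -->
  (\int[mu]_(t in Rpos) (t `^ b * polylog_prod ks t))%R /
    fine (gamma_integral b 1).
Proof.
move=> n0 nb.
have b0 : 0 < b by apply: le_lt_trans nb.
have mRpos : measurable Rpos by exact: measurable_itv.
pose g N t := (t `^ b * polylog_partial_prod ks N t)%:E.
have gE t : Rpos t -> limn (g ^~ t) = (t `^ b * polylog_prod ks t)%:E.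
  rewrite /= in_itv/= andbT => t0; apply/cvg_lim => //.
  apply: cvg_EFin; first exact: nearW.
  apply: (@cvgMr R).
  rewrite /polylog_prod (big_nth 0%N) big_mkord.
  apply: cvg_big => //; first exact: mul_continuous.
  move=> i _; rewrite /polylog_partial.
  under eq_fun do rewrite -(big_mkord xpredT
    (fun m => expR (- t) ^+ m.+1 / m.+1%:R ^+ nth 0%N ks i)).
  by apply: cvg_polylog; exact: expRN_itv.
have := @cvg_monotone_convergence _ _ _ mu Rpos mRpos g.
have mg N : measurable_fun Rpos (g N).
  apply/measurable_EFinP; apply: measurable_funM.
    by apply: measurable_gt0; exact: measurable_powR.
  apply: measurable_prod => i _; apply: measurable_sum => m.
  apply: measurable_funM => //.
  apply: measurable_funX; apply: measurable_gt0.
  by apply: measurableT_comp => //; exact: measurableT_comp.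
have g0 N t : Rpos t -> (0 <= g N t)%E.
  move=> _; rewrite lee_fin mulr_ge0 ?powR_ge0// prodr_ge0// => i _.
  exact: polylog_partial_ge0.
have ndg t : Rpos t -> nondecreasing_seq (g ^~ t).
  move=> _ N M NM; rewrite lee_fin ler_wpM2l ?powR_ge0//.
  apply: ler_prod => i _; rewrite polylog_partial_ge0/=.
  rewrite /polylog_partial (big_ord_widen M
    (fun m => expR (- t) ^+ m.+1 / m.+1%:R ^+ nth 0%N ks i) NM).
  by rewrite big_mkcond; apply: ler_sum => m _; case: ifP.
move=> /(_ mg g0 ndg); rewrite [X in _ --> X](_ : _ =
    (\int[mu]_(t in Rpos) (t `^ b * polylog_prod ks t)%:E)%E); last first.
  by apply: eq_integral => t /set_mem/gE.
move=> cg.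
have G0 := gamma_integral_gt0 b0.
have Gfin := gamma_integral_fin_num b0 ltr01.
have fG0 : 0 < fine (gamma_integral b 1) by rewrite fine_gt0// G0 ltey_eq Gfin.
have If : (\int[mu]_(t in Rpos) (t `^ b * polylog_prod ks t)%:E)%E \is a fin_num.
  exact/integrable_fin_num/integrable_polylog_prod.
have -> : (fun N =>
      \sum_(f : {ffun 'I_(size ks) -> 'I_N}) @mt_term ks b (fun i => f i)) =
    (fun N => fine (\int[mu]_(t in Rpos) g N t)%E / fine (gamma_integral b 1)).
  apply/funext => N.
  rewrite /g integral_polylog_partial_prod// -(fineK Gfin) -EFinM/=.
  by rewrite mulfK// gt_eqF.
apply: cvgMl.
by apply: fine_cvg; rewrite /Rintegral fineK.
Qed.

End BoxSums.

(** * Unconditional sums of nonnegative families *)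

Section UnconditionalSums.
Variable R : realType.
Implicit Types (n N : nat).

Lemma cvg_realC (T : Type) (F : set_system T) (FF : Filter F) (f : T -> R) (l : R) :
  f @ F --> l -> (fun x => (f x)%:C : R[i]^o) @ F --> (l%:C : R[i]^o).
Proof.
move=> fl P Pl.
have Pl' : \forall z \near (0 + l%:C * 1 : R[i]^o), P z by rewrite add0r mulr1.
have h : \forall u \near l, P u%:C.
  by apply: filterS (near_segment Pl') => u; rewrite add0r mulr1.
exact: (fl _ h).
Qed.

Lemma ler_sum_uniq_subset (I : eqType) (s1 s2 : seq I) (w : I -> R) :
  (forall i, 0 <= w i) -> uniq s1 -> {subset s1 <= s2} -> uniq s2 ->
  \sum_(i <- s1) w i <= \sum_(i <- s2) w i.
Proof.
move=> w0 u1 s12 u2.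
have /permPl/(perm_big _) -> : perm_eql s1 [seq i <- s2 | i \in s1].
  apply/permPl/uniq_perm => //; first exact: filter_uniq.
  move=> i; rewrite mem_filter; case: (boolP (i \in s1)) => //= /s12.
  by move=> ->.
by rewrite big_filter big_mkcond; apply: ler_sum => i _; case: ifP.
Qed.

Definition box n N : seq {ffun 'I_n -> nat} :=
  [seq [ffun i => f i : nat] | f : {ffun 'I_n -> 'I_N}].

Lemma uniq_box n N : uniq (box n N).
Proof.
rewrite map_inj_uniq ?enum_uniq// => f g fg; apply/ffunP => i; apply/val_inj.
by have /ffunP/(_ i) := fg; rewrite !ffunE.
Qed.

Lemma mem_box n N (m : {ffun 'I_n -> nat}) : (m \in box n N) = [forall i, (m i < N)%N].
Proof.
apply/mapP/forallP => [[f _ ->] i|mN]; first by rewrite ffunE.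
exists [ffun i => Ordinal (mN i)]; first by rewrite mem_enum.
by apply/ffunP => i; rewrite !ffunE.
Qed.

Lemma sum_box n N (w : {ffun 'I_n -> nat} -> R) :
  \sum_(m <- box n N) w m = \sum_(f : {ffun 'I_n -> 'I_N}) w [ffun i => f i : nat].
Proof. by rewrite /box big_image. Qed.

Lemma seq_subset_box n (s : seq {ffun 'I_n -> nat}) :
  exists N, {subset s <= box n N}.
Proof.
exists (\max_(m <- s) \max_(i < n) m i).+1 => m ms; rewrite mem_box.
apply/forallP => i; rewrite ltnS.
have := @leq_bigmax_seq _ s xpredT
  (fun m : {ffun 'I_n -> nat} => \max_(i < n) m i) m ms isT.
exact/leq_trans/(leq_bigmax i).
Qed.

(** For nonnegative terms the net of all finite partial sums is increasing and the
    boxes are cofinal in it, so convergence along the boxes is convergence of the net. *)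
Lemma sum_cvg_box n (w : {ffun 'I_n -> nat} -> R) (l : R) :
  (forall m, 0 <= w m) ->
  \sum_(f : {ffun 'I_n -> 'I_N}) w [ffun i => f i : nat] @[N --> \oo] --> l ->
  summability.sum (R := R[i]^o) (fun m => (w m)%:C : R[i]^o) = l%:C.
Proof.
move=> w0 wl.
have totF := @summability.totally_filter {ffun 'I_n -> nat}.
apply: cvg_lim => //.
pose W (J : {fset {ffun 'I_n -> nat}}) := \sum_(i <- J) w i.
rewrite (_ : summability.partial_sum _ = (fun J => (W J)%:C : R[i]^o)); last first.
  apply/funext => J; rewrite /summability.partial_sum /W rmorph_sum/=.
  by rewrite [RHS]big_seq_fsetE.
apply: cvg_realC.
have ndB : nondecreasing_seq (fun N => \sum_(m <- box n N) w m).
  move=> N M NM; apply: ler_sum_uniq_subset => //; try exact: uniq_box.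
  move=> m; rewrite !mem_box => /forallP mN; apply/forallP => i.
  exact: leq_trans (mN i) NM.
have cB : \sum_(m <- box n N) w m @[N --> \oo] --> l.
  by under eq_cvg do rewrite sum_box.
have Wl J : W J <= l.
  have [N JN] := seq_subset_box (enum_fset J).
  have := nondecreasing_cvgn_le ndB (cvgP _ cB) N.
  rewrite (cvg_lim _ cB)//; apply: le_trans.
  by apply: ler_sum_uniq_subset => //; exact: uniq_box.
apply/cvgrPdist_lt => e e0.
move/cvgrPdist_lt : cB => /(_ e e0)[N _ /(_ N (leqnn N)) /= hN].
exists [fset m in box n N]%fset => // J /= BJ.
have BW : \sum_(m <- box n N) w m <= W J.
  apply: ler_sum_uniq_subset; rewrite ?uniq_box ?fset_uniq// => m mB.
  by move/fsubsetP : BJ; apply; rewrite inE.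
rewrite ger0_norm ?subr_ge0 ?Wl//.
apply: le_lt_trans hN; apply: le_trans (ler_norm _).
by rewrite lerB.
Qed.

End UnconditionalSums.

(** * Values of zeta, xi and zeta_MT at real points *)

Section RealPoints.
Variable R : realType.
Implicit Types (a b c t : R) (k n N j : nat) (ks : seq nat).
Local Notation mu := (@lebesgue_measure R).
Local Notation Rpos := (`]0%R, +oo[%classic : set R).

Lemma cpow_real t a : cpow t a%:C = (t `^ a)%:C.
Proof. by rewrite /cpow /= mul0r cos0 sin0 mulr1. Qed.

Lemma natrC n : (n%:R : R)%:C = n%:R :> R[i].
Proof. by rewrite rmorph_nat. Qed.

Lemma Cint0oo_real (F : R -> R[i]) (f : R -> R) :
  (forall t, 0 < t -> F t = (f t)%:C) ->
  Cint0oo F = (\int[mu]_(t in Rpos) f t)%R%:C.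
Proof.
move=> Ff; rewrite /Cint0oo.
apply/eqP; rewrite eq_complex/=; apply/andP; split; apply/eqP.
  by apply: eq_Rintegral => t; rewrite in_gt0_itv => /Ff ->.
transitivity (\int[mu]_(t in Rpos) (0 : R))%R; last by rewrite /Rintegral integral0.
by apply: eq_Rintegral => t; rewrite in_gt0_itv => /Ff ->.
Qed.

Definition Gamma a : R := fine (gamma_integral (a - 1) 1).

Lemma Gamma_gt0 a : 1 < a -> 0 < Gamma a.
Proof.
move=> a1; have b0 : 0 < a - 1 by rewrite subr_gt0.
by rewrite fine_gt0// gamma_integral_gt0//= gamma_integral_lty.
Qed.

Lemma Gamma_pochhammer a j : 1 < a ->
  Gamma (a + j%:R) = \prod_(i < j) (a + i%:R) * Gamma a.
Proof.
move=> a1; elim: j => [|j IH]; first by rewrite addr0 big_ord0 mul1r.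
rewrite big_ord_recr/= mulrAC -IH /Gamma.
have aj0 : 0 < a + j%:R - 1 by rewrite addrAC ltr_wpDr// subr_gt0.
have -> : a + j.+1%:R - 1 = a + j%:R - 1 + 1 by rewrite -natr1; ring.
rewrite gamma_integral_rec// -(fineK (gamma_integral_fin_num aj0 ltr01)) -EFinM/=.
by rewrite mulrC subrK.
Qed.

Lemma Euler_Gamma_real a : Euler_Gamma a%:C = (Gamma a)%:C.
Proof.
apply: Cint0oo_real => t t0.
rewrite -[X in cpow _ (_ - X)](rmorph1 (real_complex R)).
by rewrite -rmorphB cpow_real -rmorphM/= mul1r mulrC.
Qed.

Lemma inv_Gamma_real a : 0 < a -> inv_Gamma a%:C = (Gamma a)^-1%:C.
Proof.
move=> a0; rewrite /inv_Gamma /= a0 /pochhammer big_ord0 addr0.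
by rewrite Euler_Gamma_real mul1r fmorphV.
Qed.

Lemma zetaMT_series_real ks a : (0 < size ks)%N -> (size ks)%:R + 1 < a ->
  zetaMT_series ks a%:C =
  ((\int[mu]_(t in Rpos) (t `^ (a - 1) * polylog_prod ks t))%R / Gamma a)%:C.
Proof.
move=> n0; rewrite -ltrBrDr => na.
rewrite /zetaMT_series.
rewrite (_ : (fun m => _) = (fun m : {ffun 'I_(size ks) -> nat} =>
    (mt_term (a - 1) m)%:C : R[i]^o)); last first.
  by apply/funext => m; rewrite -rmorphN cpow_real -rmorphM /mt_term subrK.
apply: sum_cvg_box => [m|]; first exact: mt_term_ge0.
have := cvg_box_sum n0 na; apply: cvg_trans; apply: near_eq_cvg.
apply: nearW => N; apply: eq_bigr => f _; congr mt_term.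
by apply/funext => i; rewrite ffunE.
Qed.

(** The case of one index of the Mordell-Tornheim integral: a box in dimension 1 is
    an initial segment, so the ordinary partial sums are box sums. *)
Lemma zeta_series_real a : 2 < a ->
  zeta_series a%:C =
  ((\int[mu]_(t in Rpos) (t `^ (a - 1) * polylog_prod [:: 0%N] t))%R / Gamma a)%:C.
Proof.
move=> a2; rewrite /zeta_series; apply: (@cvg_lim R[i]^o) => //.
have a1 : (size [:: 0%N])%:R < a - 1 by rewrite /=; lra.
have h0 := cvg_realC _ (@cvg_box_sum R [:: 0%N] (a - 1) isT a1).
apply: (cvg_trans _ (h0 _)); apply: near_eq_cvg; apply: nearW => N.
rewrite /series/= big_mkord rmorph_sum/=.
have := @bigA_distr_bigA R 0 1 *%R +%R 'I_1 'I_N (fun _ m => m.+1%:R `^ (- a)).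
rewrite big_ord1 => h.
rewrite -[LHS]rmorph_sum.
transitivity ((\sum_(m < N) m.+1%:R `^ (- a) : R)%:C); last first.
  by rewrite rmorph_sum; apply: eq_bigr => m _; rewrite -rmorphN cpow_real.
congr (_%:C); rewrite h; apply: eq_bigr => f _.
by rewrite /mt_term !big_ord1 /= expr0 invr1 mul1r subrK.
Qed.

Lemma zeta_series2 : zeta_series (2 : R[i]) = (polylog 2 (1 : R))%:C.
Proof.
rewrite /zeta_series; apply: (@cvg_lim R[i]^o) => //.
have h0 := cvg_realC _ (@cvg_polylog2_1 R).
apply: (cvg_trans _ (h0 _)); apply: near_eq_cvg.
apply: nearW => N; rewrite /series/= rmorph_sum; apply: eq_bigr => m _.
by rewrite -natrC -rmorphN cpow_real powR_invn// expr1n mul1r.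
Qed.

Lemma prod_nseq (T : Type) (x : T) (f : T -> R) j :
  \prod_(k <- nseq j x) f k = f x ^+ j.
Proof. by elim: j => [|j IH]; rewrite ?big_nil//= big_cons IH exprS. Qed.

Definition xi_integrand a j t : R :=
  t `^ (a - 1) * ((expR t - 1)^-1 * polylog 2 (1 - expR (- t)) ^+ j).

Lemma xiMT_integral_real j a : 0 < a ->
  xiMT_integral (nseq j 2%N) a%:C =
  ((\int[mu]_(t in Rpos) xi_integrand a j t)%R / Gamma a)%:C.
Proof.
move=> a0; rewrite /xiMT_integral inv_Gamma_real// mulrC rmorphM; congr (_ * _).
apply: Cint0oo_real => t t0; rewrite prod_nseq.
rewrite -[X in cpow _ (_ - X)](rmorph1 (real_complex R)).
by rewrite -rmorphB cpow_real -rmorphM.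
Qed.

End RealPoints.

(** * The two integrands *)

Section Binomial.
Variable R : realType.
Implicit Types (a b c t : R) (k n N j : nat) (ks : seq nat).
Local Notation mu := (@lebesgue_measure R).
Local Notation Rpos := (`]0%R, +oo[%classic : set R).

(** Measurability is read off the reflection formula, whose other terms are limits
    of measurable partial sums. *)
Lemma measurable_polylog2_onem :
  measurable_fun Rpos (fun t => polylog 2 (1 - expR (- t))).
Proof.
apply: (@eq_measurable_fun _ _ _ _ _ (fun t => polylog 2 1 -
  (polylog 2 (expR (- t)) + t * polylog 1 (expR (- t))))).
  by move=> t; rewrite in_gt0_itv => /dilog_reflection <-; rewrite addrK.
apply: measurable_funB => //; apply: measurable_funD.
  exact: measurable_polylog_expRN.
by apply: measurable_funM => //; exact: measurable_polylog_expRN.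
Qed.

(** The factor [polylog 2 (1 - expR (- t))] is bounded by [polylog 2 1], which
    reduces the claim to [j = 0]. *)
Lemma integrable_xi_integrand a j : 2 < a ->
  mu.-integrable Rpos (EFin \o xi_integrand a j).
Proof.
move=> a2.
have mRpos : measurable Rpos by exact: measurable_itv.
have mpow : measurable_fun Rpos (fun t => t `^ (a - 1)).
  by apply: measurable_gt0; exact: measurable_powR.
have a1 : (size [:: 0%N])%:R < a - 1 by rewrite /=; lra.
have h0 := @integrable_polylog_prod R (a - 1) [:: 0%N] isT a1.
have h1 : mu.-integrable Rpos (fun t => ((polylog 2 1 ^+ j)%:E *
    (t `^ (a - 1) * polylog_prod [:: 0%N] t)%:E)%E).
  by apply: integrableZl => //; exact: h0.
apply: le_integrable h1 => //.
  apply/measurable_EFinP.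
  apply: (@eq_measurable_fun _ _ _ _ _ (fun t => t `^ (a - 1) *
    (polylog 0 (expR (- t)) * polylog 2 (1 - expR (- t)) ^+ j))).
    by move=> t; rewrite in_gt0_itv => t0; rewrite polylog0_expRN.
  apply: measurable_funM => //; apply: measurable_funM.
    exact: measurable_polylog_expRN.
  by apply: measurable_funX; exact: measurable_polylog2_onem.
move=> t; rewrite /= in_itv/= andbT => t0; rewrite lee_fin.
have p01 := onem_expRN_itv (ltW t0).
have D0 := polylog_ge0 2 p01; have DZ := polylog2_le p01.
have L0 : 0 <= (expR t - 1)^-1 by rewrite invr_ge0 subr_ge0 ltW// expR_gt1.
rewrite /xi_integrand /polylog_prod big_seq1 polylog0_expRN//.
have tL0 : 0 <= t `^ (a - 1) * (expR t - 1)^-1 by rewrite mulr_ge0 ?powR_ge0.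
have DZj : polylog 2 (1 - expR (- t)) ^+ j <= polylog 2 1 ^+ j.
  by rewrite lerXn2r ?qualifE//= (le_trans D0 DZ).
have Dj0 : 0 <= polylog 2 (1 - expR (- t)) ^+ j by rewrite exprn_ge0.
rewrite mulrA ger0_norm ?mulr_ge0//.
rewrite ger0_norm ?mulr_ge0 ?(le_trans Dj0 DZj) ?powR_ge0//.
  by rewrite [leRHS]mulrC ler_wpM2l.
exact: powR_ge0.
Qed.

Lemma Rintegral_lincomb n (c : nat -> R) (f : nat -> R -> R) :
  (forall j, (j < n)%N -> mu.-integrable Rpos (EFin \o f j)) ->
  mu.-integrable Rpos (EFin \o (fun t => \sum_(0 <= j < n) c j * f j t)) /\
  (\int[mu]_(t in Rpos) (\sum_(0 <= j < n) c j * f j t) =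
    \sum_(0 <= j < n) c j * (\int[mu]_(t in Rpos) f j t))%R.
Proof.
have mRpos : measurable Rpos by exact: measurable_itv.
elim: n => [|n IH] fi.
  have h : mu.-integrable Rpos (cst 0%E) by apply: integrable0.
  split; first by apply: eq_integrable h => // t _; rewrite /= big_geq.
  rewrite [RHS]big_geq//; transitivity (\int[mu]_(t in Rpos) (0 : R))%R.
    by apply: eq_Rintegral => t _; rewrite big_geq.
  by rewrite /Rintegral integral0.
have [i1 e1] := IH (fun j jn => fi j (ltnW jn)).
have i2 : mu.-integrable Rpos (EFin \o (fun t => c n * f n t)).
  have h : mu.-integrable Rpos (fun t => ((c n)%:E * (f n t)%:E)%E).
    by apply: integrableZl => //; exact: fi.
  by apply: eq_integrable h => // t _; rewrite /= EFinM.
split.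
  have h : mu.-integrable Rpos ((EFin \o (fun t => (\sum_(0 <= j < n) c j * f j t)%R)) \+
      (EFin \o (fun t => (c n * f n t)%R)))%E by apply: integrableD.
  by apply: eq_integrable h => // t _; rewrite /= big_nat_recr//= EFinD.
transitivity (\int[mu]_(t in Rpos) (\sum_(0 <= j < n) c j * f j t + c n * f n t))%R.
  by apply: eq_Rintegral => t _; rewrite big_nat_recr.
rewrite RintegralD// e1 [RHS]big_nat_recr//=; congr (_ + _).
by rewrite RintegralZl//; exact: fi.
Qed.

Definition mt_index n j : seq nat := (nseq (n - j) 2 ++ nseq j 1 ++ [:: 0])%N.

Lemma size_mt_index n j : (j <= n)%N -> size (mt_index n j) = n.+1.
Proof. by move=> jn; rewrite !size_cat !size_nseq addnA subnK// addn1. Qed.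

(** By the binomial theorem the left-hand side is
    [t `^ (a - 1) / (expR t - 1) * (polylog 2 1 - polylog 2 (1 - expR (- t))) ^+ n].
    The reflection formula turns the base of the power into
    [polylog 2 (expR (- t)) + t * polylog 1 (expR (- t))], and the binomial theorem
    expands it again; each factor [t] raises the exponent of [t] by one. *)
Lemma xi_mt_integrand_eq n a t : 0 < t ->
  \sum_(0 <= j < n.+1) 'C(n, j)%:R * (-1) ^+ j * polylog 2 1 ^+ (n - j) *
     xi_integrand a j t =
  \sum_(0 <= j < n.+1) 'C(n, j)%:R *
    (t `^ (a + j%:R - 1) * polylog_prod (mt_index n j) t).
Proof.
move=> t0; set L0 := (expR t - 1)^-1; set D := polylog 2 (1 - expR (- t)).
set L1 := polylog 1 (expR (- t)); set L2 := polylog 2 (expR (- t)).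
transitivity (t `^ (a - 1) * L0 * (polylog 2 1 - D) ^+ n).
  rewrite exprDn -(big_mkord xpredT
    (fun i => polylog 2 1 ^+ (n - i) * (- D) ^+ i *+ 'C(n, i))).
  rewrite mulr_sumr; apply: eq_bigr => j _.
  by rewrite /xi_integrand -/L0 -/D [(- D) ^+ j]exprNn -mulr_natl; ring.
rewrite -(dilog_reflection t0) -/D addrAC subrr add0r -/L1 -/L2.
rewrite exprDn -(big_mkord xpredT
  (fun i => L2 ^+ (n - i) * (t * L1) ^+ i *+ 'C(n, i))).
rewrite mulr_sumr; apply: eq_bigr => j _.
rewrite /polylog_prod !big_cat/= big_seq1 !prod_nseq polylog0_expRN//.
rewrite -/L0 -/L1 -/L2 exprMn -mulr_natl.
have -> : t `^ (a + j%:R - 1) = t `^ (a - 1) * t ^+ j.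
  by rewrite addrAC (@powRD _ t (a - 1)) ?(gt_eqF t0) ?implybT// powR_mulrn// ltW.
by ring.
Qed.

End Binomial.

(** * The identity *)

Section RealAxis.
Variable R : realType.
Implicit Types (a b c t : R) (k n N j : nat) (ks : seq nat).
Local Notation mu := (@lebesgue_measure R).
Local Notation Rpos := (`]0%R, +oo[%classic : set R).

Lemma is_xiMT_meromorphic ks (xi : R[i] -> R[i]) : is_xiMT ks xi -> meromorphic xi.
Proof. by case: ks => [|k ks] []// /entire_meromorphic. Qed.

Lemma is_xiMT_real j (xi : R[i] -> R[i]) a : is_xiMT (nseq j 2%N) xi -> 2 < a ->
  xi a%:C = ((\int[mu]_(t in Rpos) xi_integrand a j t)%R / Gamma a)%:C.
Proof.
move=> xiP a2; have a1 : 1 < a by lra.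
case: j xiP => [[_ /(_ a%:C a1) ->]|j [_ xiE]].
  rewrite zeta_series_real//; congr ((_ / _)%:C).
  apply: eq_Rintegral => t; rewrite in_gt0_itv => t0.
  by rewrite /xi_integrand /polylog_prod big_seq1 polylog0_expRN// mulr1.
rewrite xiE ?xiMT_integral_real//; first lra.
by rewrite /= ltrBlDr ltr_wpDr.
Qed.

Lemma is_zetaMT_real ks (Z : R[i] -> R[i]) a : is_zetaMT ks Z ->
  (0 < size ks)%N -> (size ks)%:R + 1 < a ->
  Z a%:C =
  ((\int[mu]_(t in Rpos) (t `^ (a - 1) * polylog_prod ks t))%R / Gamma a)%:C.
Proof.
move=> [_ ZE] n0 na; rewrite ZE ?zetaMT_series_real//=.
by apply: lt_trans na; rewrite ltrDl.
Qed.

Lemma pochhammer_real a j : pochhammer a%:C j = (\prod_(i < j) (a + i%:R))%:C.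
Proof.
by rewrite /pochhammer rmorph_prod; apply: eq_bigr => i _; rewrite rmorphD/= natrC.
Qed.

(** On the real axis both sides become one integral divided by [Gamma a]: on the
    right the Pochhammer factor is exactly [Gamma (a + j%:R) / Gamma a]. The two
    integrands agree pointwise. *)
Lemma xi_zetaMT_sum_real n a (xi : nat -> R[i] -> R[i]) (Z : nat -> R[i] -> R[i]) :
  (forall j, (j < n.+1)%N -> is_xiMT (nseq j 2%N) (xi j)) ->
  (forall j, (j < n.+1)%N -> is_zetaMT (mt_index n j) (Z j)) ->
  n.+1%:R + 1 < a ->
  \sum_(0 <= j < n.+1)
     'C(n, j)%:R * (-1) ^+ j * (polylog 2 (1 : R))%:C ^+ (n - j) * xi j a%:C =
  \sum_(0 <= j < n.+1)
     'C(n, j)%:R * pochhammer a%:C j * Z j (a%:C + j%:R).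
Proof.
move=> xiP ZP na.
have a2 : 2 < a by have := ler0n R n; move: na; rewrite -natr1; lra.
have a1 : 1 < a by lra.
have G0 := Gamma_gt0 a1.
pose c j : R := 'C(n, j)%:R * (-1) ^+ j * polylog 2 1 ^+ (n - j).
pose A j := (\int[mu]_(t in Rpos) xi_integrand a j t)%R.
pose g j t : R := t `^ (a + j%:R - 1) * polylog_prod (mt_index n j) t.
pose B j := (\int[mu]_(t in Rpos) g j t)%R.
transitivity (((\sum_(0 <= j < n.+1) c j * A j) / Gamma a)%:C : R[i]).
  rewrite mulr_suml rmorph_sum; apply: eq_big_nat => j /andP[_ jn].
  rewrite (is_xiMT_real (xiP j jn) a2) -/(A j) /c !rmorphM rmorphXn/= rmorphXn/=.
  by rewrite rmorphN1 natrC !mulrA.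
transitivity (((\sum_(0 <= j < n.+1) 'C(n, j)%:R * B j) / Gamma a)%:C : R[i]);
    last first.
  rewrite mulr_suml rmorph_sum; apply: eq_big_nat => j /andP[_ jn].
  have sj : size (mt_index n j) = n.+1 by exact: size_mt_index.
  have -> : a%:C + j%:R = (a + j%:R)%:C :> R[i] by rewrite rmorphD/= natrC.
  rewrite (is_zetaMT_real (ZP j jn)) ?sj//; last first.
    by apply: (lt_le_trans na); rewrite lerDl.
  rewrite -/(B j) pochhammer_real Gamma_pochhammer// -natrC -!rmorphM/=.
  congr (_%:C); have p0 : \prod_(i < j) (a + i%:R) != 0.
    by rewrite gt_eqF// prodr_gt0// => i _; rewrite ltr_wpDr// (lt_trans ltr01).
  by field; rewrite p0 gt_eqF.
congr ((_ / _)%:C).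
have [_ <-] := @Rintegral_lincomb R n.+1 c (xi_integrand a)
  (fun j _ => integrable_xi_integrand j a2).
have gi j : (j < n.+1)%N -> mu.-integrable Rpos (EFin \o g j).
  move=> jn; apply: integrable_polylog_prod; rewrite size_mt_index//.
  by rewrite ltrBrDr (lt_le_trans na)// lerDl.
have [_ <-] := @Rintegral_lincomb R n.+1 (fun j => 'C(n, j)%:R) g gi.
by apply: eq_Rintegral => t; rewrite in_gt0_itv => /xi_mt_integrand_eq.
Qed.

End RealAxis.

Theorem theorem8 (R : realType) (r : nat)
    (zeta : R[i] -> R[i]) (xiMT zetaMT : seq nat -> R[i] -> R[i])
    (r_gt0 : (0 < r)%N)
    (zetaP : is_zeta zeta)
    (xiMTP : forall j, (j < r)%N -> is_xiMT (nseq j 2%N) (xiMT (nseq j 2%N)))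
    (zetaMTP : forall j, (j < r)%N ->
      is_zetaMT (nseq (r - 1 - j) 2 ++ nseq j 1 ++ [:: 0])%N
        (zetaMT (nseq (r - 1 - j) 2 ++ nseq j 1 ++ [:: 0])%N)) :
  mero_eq
    (fun s => \sum_(0 <= j < r)
       'C(r - 1, j)%:R * (-1) ^+ j * zeta 2 ^+ (r - 1 - j) *
       xiMT (nseq j 2%N) s)
    (fun s => \sum_(0 <= j < r)
       'C(r - 1, j)%:R * pochhammer s j *
       zetaMT (nseq (r - 1 - j) 2 ++ nseq j 1 ++ [:: 0])%N (s + j%:R)).
Proof.
have [n rE] : exists n, r = n.+1 by exists r.-1; rewrite prednK.
have e : (n.+1 - 1 = n)%N by rewrite subn1.
rewrite rE in xiMTP zetaMTP *; rewrite e in zetaMTP *.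
have zeta2 : zeta 2 = (polylog 2 (1 : R))%:C.
  have [_ zetaE] := zetaP.
  by rewrite zetaE ?zeta_series2// -natrC ltr1n.
apply: (@meromorphic_mero_eq _ _ _ (n.+1%:R + 1)).
- apply: meromorphic_sum => j jn; apply: meromorphicZ.
  exact: is_xiMT_meromorphic (xiMTP j jn).
- apply: meromorphic_sum => j jn.
  have [mZ _] := zetaMTP j jn.
  apply: eq_meromorphic (meromorphicZ 'C(n, j)%:R
    (meromorphic_pochhammer j (meromorphic_shift j%:R mZ))) => z.
  by rewrite mulrA.
(* Beyond r + 1 all the series and integrals converge absolutely. *)
- move=> a na; rewrite zeta2.
  exact: (xi_zetaMT_sum_real (xi := fun j => xiMT (nseq j 2%N))
    (Z := fun j => zetaMT (mt_index n j))).
Qed.
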